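(* Let $d \geq 2$ and let $C_1, C_2, \ldots, C_n \subset \mathbb{S}^d$ be spherical caps such that the union of their interiors is disconnected. For $i=1,2,\ldots,n$, let $w_i:\left(0, \frac{\pi}{2} \right) \to (0,\infty)$ be $C^{\infty}$-class functions satisfying $\lim_{t \to \frac{\pi}{2}-0} w_i(t) = \infty$ for all values of $i$. For any point $q \in \mathbb{S}^d$, let $I(q)$ denote the set of the indices of the spherical caps whose boundary contains $q$, and assume that for any $q \in \mathbb{S}^d$ we have \[ \lim_{t \to \frac{\pi}{2}-0} \sum_{i \in I(q)} w_i(t) \cos t < \lim_{t \to 0+0} \sum_{i \notin I(q)} w_i(t). \] Then there is a Möbius transformation $T : \mathbb{S}^d \to \mathbb{S}^d$ such that \[ \sum_{i=1}^n w_i(\rho_T(C_i))\, c_T(C_i) = o. \]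
   Context: $\mathbb{S}^d$ is the $d$-dimensional unit sphere in $\mathbb{R}^{d+1}$ centered at the origin $o$. A spherical cap on $\mathbb{S}^d$ is a $d$-dimensional closed spherical ball of spherical radius $\rho$ with $0 < \rho < \frac{\pi}{2}$. If $T:\mathbb{S}^d \to \mathbb{S}^d$ is a Möbius transformation and $T(C)$ is a spherical cap, then $c_T(C) \in \mathbb{S}^d$ and $\rho_T(C) \in (0,\frac{\pi}{2})$ denote the (spherical) center and the spherical radius of $T(C)$, respectively; in the conclusion it is understood that every $T(C_i)$ is a spherical cap, so that these are defined. The limits in the displayed hypothesis are understood to exist in $[0,\infty]$, with empty sums equal to $0$. *)

(* Defs.v *)
From HB Require Import structures.
From mathcomp Require Import all_boot all_order all_algebra.
From mathcomp Require Import all_classical all_reals all_analysis.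
Set Implicit Arguments.
Unset Strict Implicit.
Unset Printing Implicit Defensive.
Import Order.TTheory GRing.Theory Num.Theory.
Import numFieldNormedType.Exports.
Local Open Scope classical_set_scope.
Local Open Scope ring_scope.

(* The library norm on ['rV[R]_m] is the sup norm, hence this explicit
   Euclidean inner product.  The topology on ['rV[R]_m] is the usual one. *)
Definition dot (R : realType) (m : nat) (x y : 'rV[R]_m) : R :=
  \sum_(i < m) x ord0 i * y ord0 i.

Definition sphere (R : realType) (d : nat) : set 'rV[R]_d.+1 :=
  [set x | dot x x = 1].

Definition sdist (R : realType) (d : nat) (x y : 'rV[R]_d.+1) : R :=
  acos (dot x y).

Definition is_cap (R : realType) (d : nat)
    (A : set 'rV[R]_d.+1) (c : 'rV[R]_d.+1) (rho : R) : Prop :=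
  [/\ @sphere R d c, 0 < rho, rho < pi / 2
    & A = [set x | @sphere R d x /\ sdist c x <= rho]].

(* Interior and boundary are relative to the sphere.  Points off the sphere
   are isolated in [subspace (sphere R d)]; this is harmless for
   [A `<=` sphere R d]. *)
Definition sinterior (R : realType) (d : nat)
    (A : set 'rV[R]_d.+1) : set 'rV[R]_d.+1 :=
  @interior (subspace (@sphere R d)) A.

Definition sboundary (R : realType) (d : nat)
    (A : set 'rV[R]_d.+1) : set 'rV[R]_d.+1 :=
  @closure (subspace (@sphere R d)) A `\` @interior (subspace (@sphere R d)) A.

Definition hyperplane_reflection (R : realType) (m : nat)
    (a x : 'rV[R]_m) : 'rV[R]_m :=
  x - (2 * dot x a / dot a a) *: a.

Definition sphere_inversion (R : realType) (m : nat)
    (p : 'rV[R]_m) (r : R) (x : 'rV[R]_m) : 'rV[R]_m :=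
  p + (r ^+ 2 / dot (x - p) (x - p)) *: (x - p).

(* The inversion of the unit sphere in a (d-1)-dimensional subsphere S' is the
   restriction of the reflection of R^(d+1) in the hyperplane (if S' is a great
   sphere) or in the sphere (otherwise) that meets the unit sphere orthogonally
   along S'.  Orthogonality of the sphere with center p and radius r amounts to
   |p|^2 = 1 + r^2; in particular p is off the unit sphere. *)
Inductive spherical_inversion (R : realType) (d : nat) :
    ('rV[R]_d.+1 -> 'rV[R]_d.+1) -> Prop :=
| GreatInversion (a : 'rV[R]_d.+1) of a != 0 :
    spherical_inversion (hyperplane_reflection a)
| SmallInversion (p : 'rV[R]_d.+1) (r : R) of 0 < r & dot p p = 1 + r ^+ 2 :
    spherical_inversion (sphere_inversion p r).

(* Moebius transformations of the unit sphere are the finite compositions of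
   inversions in its (d-1)-dimensional subspheres.  Maps of the sphere are
   represented by maps of the ambient space whose values off the sphere are
   irrelevant. *)
Inductive moebius (R : realType) (d : nat) :
    ('rV[R]_d.+1 -> 'rV[R]_d.+1) -> Prop :=
| MoebiusId (T : 'rV[R]_d.+1 -> 'rV[R]_d.+1) of
    (forall x, @sphere R d x -> T x = x) : moebius T
| MoebiusComp (T s U : 'rV[R]_d.+1 -> 'rV[R]_d.+1) of
    moebius T & spherical_inversion s &
    (forall x, @sphere R d x -> U x = s (T x)) : moebius U.

Definition smooth_on_itv (R : realType) (a b : R) (f : R -> R) : Prop :=
  forall (k : nat) (t : R), a < t -> t < b -> derivable (derive1n k f) t 1.

(* Main.v *)
Require Import Defs.
From HB Require Import structures.
From mathcomp Require Import all_boot all_order all_algebra.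
From mathcomp Require Import all_classical all_reals all_analysis.
From mathcomp Require Import ring lra.
Import Order.TTheory GRing.Theory Num.Theory.
Import numFieldNormedType.Exports.
Local Open Scope classical_set_scope.
Local Open Scope ring_scope.

(* A point of hyperbolic space is written in hyperboloid coordinates
   [(z, sqrt (1 + |z|^2))]. The cap with center [c] and radius [rho] becomes the
   unit spacelike vector [(a, A) = (c / sin rho, cot rho)], and the boost that
   moves [z] to the apex sends the cap to one of radius [acot L], where
   [L z = A sqrt (1 + |z|^2) - a . z], as long as [L z > 0]. With
   [phi i t = w i (acot t) sin (acot t)], a boost centers the weighted caps iff
   [z] is a critical point of [sum_i h i (L i z)], [h i] an antiderivative of
   [phi i], with all [L i z > 0].

   Since [phi i] blows up at [0], it is truncated near [0] and near infinity, at
   a level [k]; the truncated potential is defined for all [z]. As the union of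
   the interiors is disconnected, the caps split into two families such that
   [L i < 0] and [L j < 0] exclude each other for [i] and [j] in different
   families. A mountain pass between the regions belonging to the two families,
   on which the truncated potential decreases radially, gives a critical point
   [z_k] whose level is bounded uniformly in [k].

   If the [z_k] stay bounded, they are critical for the original potential once
   [k] is large. Otherwise they tend to a point [q] of the sphere along an
   ultrafilter. The critical equations then bound all the products
   [phi i (L i) L i]; if [z_k] is affected by the truncation, its height is at
   least of order [k^2], and the balance condition at [q], which compares the
   logarithmic growth rates of the [h i] at [0] and at infinity, makes the level
   of [z_k] tend to infinity, a contradiction. *)

Set Implicit Arguments.
Unset Strict Implicit.
Unset Printing Implicit Defensive.

(** The two truncations differ in size on purpose. Products [t * psi t] are capped at [k], while the
    force is frozen at [k ^ 2] near and below zero; hence one cap with [L i <= - n / k] outweighs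
    all the others, which yields the radial decrease and confines critical points to a range that
    becomes admissible as [k] grows. The level is bounded because the path does not depend on [k]
    and a truncated antiderivative lies below the original one on [[1, oo)]. The estimate from below
    is less direct, as [phi i] need not be monotone: the freezing point is taken where
    [h i t - k ^ 2 t] is maximal, so that the antiderivative there is at least about [h i (k ^ -2)].
    This matches the height of order [k ^ 2], and the level grows like the difference of the two
    rates times [ln (k ^ 2)]. The delicate case is a tangential approach to [q]: caps through [q]
    could then have large [L i], whereas their products are bounded independently of [k] only for
    [L i <= 1]. *)

Lemma ball_rVE (R : realType) m (p x : 'rV[R]_m.+1) r :
  ball p r x = (`|p - x| < r).
Proof. by have <- := @ball_normE R 'rV[R]_m.+1. Qed.

(** * A mountain pass lemma *)

Section MountainPass.
Variables (R : realType) (m : nat) (f : 'rV[R]_m.+1 -> R).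
Variables (NA NB : set 'rV[R]_m.+1) (c0 : R).
Hypothesis f_cont : continuous f.
Hypotheses (NA_open : open NA) (NB_open : open NB).
Hypothesis NAB : closure NA `&` closure NB = set0.
Hypothesis compact_sublevel :
  forall c, compact ([set x | f x <= c] `\` (NA `|` NB)).
(** This replaces a gradient flow: one direction with step sizes uniform near [p]. The regions must
    be invariant, since there is no compactness inside them. *)
Hypothesis descent : forall p, f p <= c0 -> exists v r, 0 < r /\
  forall x t, ball p r x -> 0 < t -> t < r ->
    [/\ f (x + t *: v) < f x, NA x -> NA (x + t *: v)
      & NB x -> NB (x + t *: v)].

(** The regions are counted in at every level because nothing is known about the values of [f]
    there. *)
Let sub (c : R) := [set x | f x <= c] `|` (NA `|` NB).

Let sep (c : R) := forall S, connected S -> S `<=` sub c ->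
  S `&` NA !=set0 -> S `&` NB !=set0 -> False.

Definition seg (x v : 'rV[R]_m.+1) (a : R) : set 'rV[R]_m.+1 :=
  (fun t => x + t *: v) @` `[0, a].

Lemma seg_connected x v a : connected (seg x v a).
Proof.
apply: connected_continuous_connected; first exact: segment_connected.
apply: continuous_subspaceT => t.
by apply: cvgD; [exact: cvg_cst|apply: cvgZr_tmp; exact: cvg_id].
Qed.

Let NABd x : NA x -> NB x -> False.
Proof.
move=> a b; have : (closure NA `&` closure NB) x by split; apply: subset_closure.
by rewrite NAB.
Qed.

Let sep_mono c c' : c <= c' -> sep c' -> sep c.
Proof.
move=> cc' h S Sc SS; apply: h => // x /SS [/= fx|]; last by right.
by left; exact: le_trans fx cc'.
Qed.

Section Level.
Variable cs : R.
Hypothesis cs_c0 : cs <= c0.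
Hypothesis sep_lt : forall c, c < cs -> sep c.

Let OA : set 'rV[R]_m.+1 := [set p | exists c S,
  [/\ c < cs, connected S, S `<=` sub c, S p & S `&` NA !=set0]].
Let O : set 'rV[R]_m.+1 := [set x | f x < cs] `|` (NA `|` NB).
Let OB := O `\` OA.

Let OA_glue x y c S : OA x -> c < cs -> connected S -> S `<=` sub c ->
  S x -> S y -> OA y.
Proof.
move=> [c1 [S1 [c1s S1c S1s S1x [z [S1z NAz]]]]] cc Sc Ss Sx Sy.
exists (Num.max c1 c), (S1 `|` S); split.
- by rewrite gt_max c1s.
- by apply: connectedU => //; exists x.
- move=> u [/S1s|/Ss] [/= fu|]; try by right.
    by left; rewrite /= le_max fu.
  by left; rewrite /= le_max fu orbT.
- by right.
- by exists z; split => //; left.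
Qed.

Let NA_OA : NA `<=` OA.
Proof.
move=> x xA; exists (cs - 1), [set x]; split.
- by rewrite ltrBlDr ltrDl.
- exact: connected1.
- by move=> _ ->; right; left.
- by [].
- by exists x.
Qed.

Let OA_NB x : OA x -> NB x -> False.
Proof.
move=> [c [S [ccs Sc Ss Sx SA]]] xB; apply: (sep_lt ccs Sc Ss SA).
by exists x.
Qed.

Let OA_O : OA `<=` O.
Proof.
move=> x [c [S [ccs Sc Ss Sx SA]]]; case: (Ss _ Sx) => [/= fx|]; last by right.
by left; exact: le_lt_trans fx ccs.
Qed.

Lemma ball_nbhd (p : 'rV[R]_m.+1) (A : set 'rV[R]_m.+1) : open A -> A p ->
  exists2 r : R, 0 < r & ball p r `<=` A.
Proof.
move=> oA Ap; have /nbhs_ballP[r /= r0 rA] : nbhs p A by exact: open_nbhs_nbhs.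
by exists r.
Qed.

Let lev_open c : open [set x | f x < c].
Proof. by move/continuousP : f_cont => /(_ _ (@open_lt _ c)). Qed.

Let ball_seg (p x : 'rV[R]_m.+1) r : ball p r x -> seg p (x - p) 1 `<=` ball p r.
Proof.
rewrite ball_rVE => pr _ [t /= + <-]; rewrite in_itv /= => /andP[t0 t1].
rewrite ball_rVE opprD addrA subrr add0r normrN normrZ ger0_norm//.
by apply: le_lt_trans pr; rewrite distrC ler_piMl.
Qed.

Let seg0 x v a : 0 <= a -> seg x v a x.
Proof. by move=> a0; exists 0; rewrite ?scale0r ?addr0//= in_itv/= lexx. Qed.

Let seg1 x v a : 0 <= a -> seg x v a (x + a *: v).
Proof. by move=> a0; exists a => //=; rewrite in_itv/= lexx a0. Qed.

Let low_ball p : f p < cs -> exists c r, [/\ c < cs, 0 < r & ball p r `<=` [set x | f x < c]].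
Proof.
move=> fp; exists ((f p + cs) / 2).
have [|r r0 rA] := @ball_nbhd p _ (@lev_open ((f p + cs) / 2)) => /=; first lra.
by exists r; split=> //; lra.
Qed.

Let low_link p x c r : c < cs -> ball p r `<=` [set x | f x < c] -> ball p r x ->
  OA p <-> OA x.
Proof.
move=> ccs rA prx.
have h : seg p (x - p) 1 `<=` sub c.
  by move=> u /(ball_seg prx) /rA /= fu; left; exact: ltW.
have e : x = p + 1 *: (x - p) by rewrite scale1r addrC subrK.
have p0 : seg p (x - p) 1 p by exact: seg0.
have p1 : seg p (x - p) 1 x by rewrite {2}e; exact: seg1.
split=> o; first exact: OA_glue o ccs (@seg_connected _ _ _) h p0 p1.
exact: OA_glue o ccs (@seg_connected _ _ _) h p1 p0.
Qed.

Let OA_open : open OA.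
Proof.
rewrite openE => p Op; rewrite /interior.
have [fp|[pA|pB]] := OA_O Op; last by case: (OA_NB Op pB).
  have [c [r [ccs r0 rA]]] := low_ball fp.
  by apply/nbhs_ballP; exists r => //= x /(low_link ccs rA) <-.
by apply: filterS NA_OA _; exact: open_nbhs_nbhs.
Qed.

Let OB_open : open OB.
Proof.
rewrite openE => p [Op nAp]; rewrite /interior.
have NB_OB : NB `<=` OB.
  by move=> x xB; split; [right; right|move/OA_NB; exact].
case: Op => [fp|[pA|pB]]; last 2 first.
- by case: nAp; exact: NA_OA.
- by apply: filterS NB_OB _; exact: open_nbhs_nbhs.
have [c [r [ccs r0 rA]]] := low_ball fp.
apply/nbhs_ballP; exists r => //= x xr; split.
  by left; exact: lt_trans (rA _ xr) ccs.
by move=> /(low_link ccs rA xr).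
Qed.

Let translate_nbhs (p v : 'rV[R]_m.+1) (A : set 'rV[R]_m.+1) : open A -> A (p + v) ->
  nbhs p [set x | A (x + v)].
Proof.
move=> oA Ap.
have h : continuous (fun x : 'rV[R]_m.+1 => x + v).
  by move=> x; apply: (@continuousD R 'rV[R]_m.+1 'rV[R]_m.+1 id (cst v)); [exact: cvg_id|exact: cst_continuous].
by apply: h; exact: open_nbhs_nbhs.
Qed.

(** One translation serves a whole neighborhood of [p]. A point of [O] is joined to its translate
    inside a low set, so the translation neither creates nor destroys a link to [NA]. *)
Let step p : f p = cs -> exists v t r, [/\ 0 < t, 0 < r, O (p + t *: v) &
  forall x, ball p r x -> [/\ O x -> OA x -> OA (x + t *: v),
    O x -> OA (x + t *: v) -> OA x & O x -> O (x + t *: v)]].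
Proof.
move=> fp; have := @descent p; rewrite fp => /(_ cs_c0) [v [r [r0 h]]].
have t0 : 0 < r / 2 by lra.
have t1 : r / 2 < r by lra.
have segx x : ball p r x -> f x < cs -> seg x v (r/2) `<=` sub (f x).
  move=> pr fx _ [t /= + <-]; rewrite in_itv/= => /andP[]; rewrite le_eqVlt => /predU1P[<- _|tp tr].
    by left; rewrite /= scale0r addr0.
  by left => /=; apply: ltW; have [] := h x t pr tp (le_lt_trans tr t1).
exists v, (r/2), r; split=> //.
  by left => /=; rewrite -fp; have [] := h p (r/2) (ballxx _ r0) t0 t1.
move=> x pr; have [h1 h2 h3] := h x (r/2) pr t0 t1; split.
- move=> [fx|[xA|xB]] ox.
  + by apply: (OA_glue ox fx (@seg_connected _ _ _) (segx _ pr fx)); [exact: seg0 (ltW t0)|exact: seg1 (ltW t0)].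
  + by apply: NA_OA; exact: h2.
  + by case: (OA_NB ox xB).
- move=> [fx|[xA|xB]] ox.
  + by apply: (OA_glue ox fx (@seg_connected _ _ _) (segx _ pr fx)); [exact: seg1 (ltW t0)|exact: seg0 (ltW t0)].
  + exact: NA_OA.
  + by case: (OA_NB ox (h3 xB)).
- move=> [fx|[xA|xB]].
  + by left; exact: lt_trans h1 fx.
  + by right; left; exact: h2.
  + by right; right; exact: h3.
Qed.

Let cl_disjoint : closure OA `&` closure OB = set0.
Proof.
rewrite -subset0 => p [pA pB].
case: (ltgtP (f p) cs) => [fp|fp|fp].
- have [oA|oA] := pselect (OA p).
    have [x [[_ xA] xA']] := pB OA (open_nbhs_nbhs (conj OA_open oA)).
    by [].
  have oB : OB p by split=> //; left.
  by have [x [xA [_ xA']]] := pA OB (open_nbhs_nbhs (conj OB_open oB)).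
(* Above the level [cs], points of [OA] near [p] lie in [NA] and points of [OB] in [NB], and these
   have disjoint closures. *)
- have hn : nbhs p [set x | cs < f x].
    apply: open_nbhs_nbhs; split=> //.
    by move/continuousP : f_cont => /(_ _ (@open_gt _ cs)).
  have : (closure NA `&` closure NB) p.
    split=> U nU.
      have [x [xA [Ux /= fx]]] := pA _ (filterI nU hn); exists x; split => //.
      case: (OA_O xA) => [/= /lt_trans /(_ fx)|[//|/OA_NB]]; first by rewrite ltxx.
      by case.
    have [x [[xO xA] [Ux /= fx]]] := pB _ (filterI nU hn); exists x; split => //.
    case: (xO) => [/= /lt_trans /(_ fx)|[|//]]; first by rewrite ltxx.
    by move/NA_OA.
  by rewrite NAB.
- have [v [t [r [t0 r0 Op h]]]] := step fp.
  have nr : nbhs p (ball p r) by exact: nbhsx_ballx.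
  have [oA|oA] := pselect (OA (p + t *: v)).
    have := translate_nbhs OA_open oA => nA.
    have [x [[xO xA] [/h [_ h2 _] /= xA']]] := pB _ (filterI nr nA).
    by apply: xA; exact: h2.
  have nB := @translate_nbhs p (t *: v) OB OB_open (conj Op oA).
  have [x [xA [/h [h1 _ _] /= [_ xA']]]] := pA _ (filterI nr nB).
  by apply: xA'; apply: h1 => //; exact: OA_O.
Qed.

(** At the level [cs] itself, arbitrarily short descent steps from [p] end in [O]. *)
Let cl_cover p : f p <= cs -> (closure OA `|` closure OB) p.
Proof.
have OE : O = OA `|` OB.
  apply/seteqP; split=> x; first by case: (pselect (OA x)); [left|right].
  by case=> [/OA_O//|[]].
rewrite -closureU -OE le_eqVlt => /predU1P[fp U nU|fp]; last first.
  by apply: subset_closure; left.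
have := @descent p; rewrite fp => /(_ cs_c0) [v [r [r0 h]]].
have hc : (fun t : R => p + t *: v) @ 0^'+ --> p.
  have : (fun t : R => p + t *: v) @ 0^'+ --> p + 0 *: v.
    apply: cvgD; first exact: cvg_cst.
    by apply: cvgZr_tmp; apply: cvg_at_right_filter; exact: cvg_id.
  by rewrite scale0r addr0.
have := hc _ nU => hU.
have : \forall t \near (0 : R)^'+, U (p + t *: v) /\ (0 < t < r).
  near=> t; split; first by near: t; exact: hU.
  apply/andP; split; first by near: t; exact: nbhs_right_gt.
  by near: t; exact: nbhs_right_lt.
move=> /filter_ex [t [Ut /andP[t0 tr]]]; exists (p + t *: v); split=> //.
by left => /=; have [+ _ _] := h p t (ballxx _ r0) t0 tr; rewrite fp.
Unshelve. all: by end_near. Qed.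

(* The part [OA] of the region below [cs] that is linked to [NA] and the rest
   [OB] have disjoint closures, since a descent step moves a common limit point
   of level [cs] into one of the two open sets. The compact rest of the level
   then stays away from them. *)
Lemma sep_next : exists2 e, 0 < e & sep (cs + e).
Proof.
have [U [V [oU oV clU clV UV0]]] : exists U V, [/\ open U, open V,
    closure OA `<=` U, closure OB `<=` V & U `&` V = set0].
  have /(@normal_openP R) h := @pseudometric_normal R 'rV[R]_m.+1.
  exact: (h _ _ (@closed_closure _ OA) (@closed_closure _ OB) cl_disjoint).
have NA_U : NA `<=` U by move=> x /NA_OA xA; apply: clU; exact: subset_closure.
have NB_V : NB `<=` V.
  move=> x xB; apply: clV; apply: subset_closure; split; first by right; right.
  by move/OA_NB; exact.
pose K := ([set x | f x <= cs + 1] `\` (NA `|` NB)) `&` ~` (U `|` V).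
have Kc : compact K.
  apply: (subclosed_compact _ (@compact_sublevel (cs + 1))); last by move=> x [].
  rewrite /K setDE; apply: closedI; last first.
    by apply: open_closedC; exact: openU.
  apply: closedI; last by apply: open_closedC; exact: openU.
  rewrite (_ : [set x | _] = f @^-1` [set y | y <= cs + 1])//.
  by apply: closed_comp; [move=> x _; exact: f_cont|exact: closed_le].
have [e e0 [e1 he]] : exists2 e, 0 < e & e <= 1 /\ forall x, f x <= cs + e -> (U `|` V) x.
  have [K0|nK0] := pselect (K = set0).
    exists 1 => //; split=> // x fx; apply: contrapT => nUV.
    have : K x by split=> //; split=> // -[/NA_U|/NB_V] ?; apply: nUV; [left|right].
    by rewrite K0.
  have K1 : K !=set0 by apply/set0P/eqP.
  have [k0 /set_mem [[/= fk _] nk] hk] := EVT_min_rV K1 Kc (continuous_subspaceT f_cont).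
  have fk0 : cs < f k0.
    rewrite ltNge; apply/negP => /cl_cover [/clU|/clV] ?; apply: nk; [by left|by right].
  exists ((f k0 - cs) / 2); first lra.
  split; first lra.
  move=> x fx; apply: contrapT => nUV.
  have : K x by split=> //; split=> [/=|[/NA_U|/NB_V] ?]; [lra|apply: nUV; left|apply: nUV; right].
  by move/mem_set/hk; lra.
exists e => // S Sc Ss [a [Sa Aa]] [b [Sb Bb]].
have SUV : S `<=` U `|` V.
  move=> x /Ss [/= /he//|[/NA_U|/NB_V]]; [by left|by right].
have sUV : separated U V.
  have UV y : U y -> V y -> False.
    by move=> Uy Vy; have : (U `&` V) y by []; rewrite UV0.
  split; rewrite -subset0 => x [].
    by move=> clx Vx; have [y [/UV h /h]] := clx V (open_nbhs_nbhs (conj oV Vx)).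
  by move=> Ux clx; have [y [/[swap] /UV h /h]] := clx U (open_nbhs_nbhs (conj oU Ux)).
have [SU|SV] := connected_subset sUV SUV Sc.
  have : (U `&` V) b by split; [exact: SU|exact: NB_V].
  by rewrite UV0.
have : (U `&` V) a by split; [exact: NA_U|exact: SV].
by rewrite UV0.
Qed.

End Level.

(** Below the minimum of [f] outside the regions, only the two separated sets [NA] and [NB] remain.
    This makes the set of separated levels nonempty. *)
Let sep_low : exists2 c, c <= c0 & sep c.
Proof.
pose K := [set x | f x <= c0] `\` (NA `|` NB).
have [c cc0 hc] : exists2 c, c <= c0 & forall x, f x <= c -> (NA `|` NB) x.
  have [K0|K1] := pselect (K = set0).
    exists c0 => // x fx; apply: contrapT => nx.
    by have : K x by []; rewrite K0.
  have {}K1 : K !=set0 by apply/set0P/eqP.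
  have [k0 /set_mem [/= fk _] hk] :=
    EVT_min_rV K1 (@compact_sublevel c0) (continuous_subspaceT f_cont).
  exists (f k0 - 1); first lra.
  move=> x fx; apply: contrapT => nx.
  have : K x by split=> //=; lra.
  by move/mem_set/hk; lra.
exists c => // S Sc Ss [a [Sa Aa]] [b [Sb Bb]].
have SAB : S `<=` NA `|` NB by move=> x /Ss [/= /hc|].
have sAB : separated NA NB.
  split; rewrite -subset0 -NAB => x [xA xB]; split=> //; exact: subset_closure.
have [SU|SV] := connected_subset sAB SAB Sc.
  by apply: (@NABd b) => //; exact: SU.
by apply: (@NABd a) => //; exact: SV.
Qed.

(** The supremum of the separated levels up to [c0] can be exceeded by [sep_next], so that [c0] is
    separated, against [S]. In the application [descent] follows from the absence of critical
    points, and the contradiction produces one. *)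
Lemma mountain_pass (S : set 'rV[R]_m.+1) : connected S ->
  S `<=` [set x | f x <= c0] -> S `&` NA !=set0 -> S `&` NB !=set0 -> False.
Proof.
move=> Sc Ss SA SB.
have nsep : ~ sep c0 by move=> /(_ S Sc) h; apply: h => // x /Ss; left.
have [c1 c1c0 sc1] := sep_low.
pose E := [set c | c <= c0 /\ sep c].
have E0 : has_sup E by split; [exists c1|exists c0 => c []].
pose cs := sup E.
have cs_c0 : cs <= c0 by apply: ge_sup; [exists c1|move=> c []].
have hlt c : c < cs -> sep c.
  move=> ccs; have [|c2 [_ sc2] cc2] := @sup_adherent _ E (cs - c) _ E0.
    by rewrite subr_gt0.
  apply: sep_mono sc2; rewrite -/cs in cc2; lra.
have [e e0 se] := @sep_next cs cs_c0 hlt.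
have [h|h] := leP (cs + e) c0; last by apply: nsep; apply: sep_mono se; exact: ltW.
have : cs + e <= cs by apply: ub_le_sup => //; exists c0 => c [].
lra.
Qed.

End MountainPass.

(** * Caps, hyperboloid coordinates and boosts *)

Section Dot.
Variables (R : realType) (m : nat).
Implicit Types (x y z : 'rV[R]_m) (k : R).

Lemma dotC x y : dot x y = dot y x.
Proof. by apply: eq_bigr => i _; rewrite mulrC. Qed.

Lemma dotDl x y z : dot (x + y) z = dot x z + dot y z.
Proof. by rewrite -big_split; apply: eq_bigr => i _ /=; rewrite !mxE mulrDl. Qed.

Lemma dotZl k x z : dot (k *: x) z = k * dot x z.
Proof. by rewrite /dot mulr_sumr; apply: eq_bigr => i _; rewrite !mxE mulrA. Qed.

Lemma dotNl x z : dot (- x) z = - dot x z.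
Proof. by rewrite -scaleN1r dotZl mulN1r. Qed.

Lemma dotBl x y z : dot (x - y) z = dot x z - dot y z.
Proof. by rewrite dotDl dotNl. Qed.

Lemma dotDr x y z : dot z (x + y) = dot z x + dot z y.
Proof. by rewrite dotC dotDl !(dotC z). Qed.

Lemma dotZr k x z : dot z (k *: x) = k * dot z x.
Proof. by rewrite dotC dotZl (dotC z). Qed.

Lemma dotNr x z : dot z (- x) = - dot z x.
Proof. by rewrite dotC dotNl (dotC z). Qed.

Lemma dotBr x y z : dot z (x - y) = dot z x - dot z y.
Proof. by rewrite dotDr dotNr. Qed.

Definition dotE := (dotDl, dotDr, dotNl, dotNr, dotZl, dotZr).

Lemma dot0l z : dot 0 z = 0.
Proof. by rewrite -(scale0r z) dotZl mul0r. Qed.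

Lemma dot0r z : dot z 0 = 0.
Proof. by rewrite dotC dot0l. Qed.

Lemma dot_suml (I : Type) (r : seq I) (P : pred I) (F : I -> 'rV[R]_m) z :
  dot (\sum_(i <- r | P i) F i) z = \sum_(i <- r | P i) dot (F i) z.
Proof. by apply: (big_morph (fun x => dot x z) (fun x y => dotDl x y z) (dot0l z)). Qed.

Lemma dot_ge0 x : 0 <= dot x x.
Proof. by apply: sumr_ge0 => i _; rewrite -expr2 sqr_ge0. Qed.

Lemma dot_eq0 x : (dot x x == 0) = (x == 0).
Proof.
apply/idP/eqP => [|->]; last by rewrite dot0l.
rewrite psumr_eq0; last by move=> i _; rewrite -expr2 sqr_ge0.
move=> /allP h; apply/rowP => i; rewrite mxE.
by have := h i (mem_index_enum i); rewrite mulf_eq0 orbb => /eqP.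
Qed.

Lemma dot_gt0 x : x != 0 -> 0 < dot x x.
Proof. by move=> x0; rewrite lt_neqAle dot_ge0 eq_sym dot_eq0 x0. Qed.

Lemma dot_CS x y : dot x y ^+ 2 <= dot x x * dot y y.
Proof.
have [->|y0] := eqVneq y 0; first by rewrite !dot0r mulr0 expr0n.
have := dot_ge0 (dot y y *: x - dot x y *: y).
rewrite !dotE (dotC y x) => h.
have := dot_gt0 y0 => yy.
by rewrite -subr_ge0 -(pmulr_rge0 _ yy); apply: le_trans h _; rewrite le_eqVlt; apply/orP; left; apply/eqP; ring.
Qed.

Lemma dot_le_norm x y : dot x y <= Num.sqrt (dot x x) * Num.sqrt (dot y y).
Proof.
rewrite -sqrtrM ?dot_ge0//; apply: le_trans (ler_norm _) _.
by rewrite -sqrtr_sqr ler_sqrt ?dot_CS// mulr_ge0 ?dot_ge0.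
Qed.

Lemma coord_le_norm x i : `|x ord0 i| <= Num.sqrt (dot x x).
Proof.
rewrite -sqrtr_sqr ler_sqrt ?dot_ge0// /dot (bigD1 i)//= -expr2 lerDl.
by apply: sumr_ge0 => j _; rewrite -expr2 sqr_ge0.
Qed.

Lemma cvg_sumr (T I : Type) (F : set_system T) (FF : Filter F) (r : seq I)
    (P : pred I) (f : I -> T -> R) (a : I -> R) :
  (forall i, P i -> f i t @[t --> F] --> a i) ->
  \sum_(i <- r | P i) f i t @[t --> F] --> \sum_(i <- r | P i) a i.
Proof. by move=> h; apply: cvg_big => //; exact: add_continuous. Qed.

Lemma dot_cvg (T : Type) (F : set_system T) (FF : Filter F) (f g : T -> 'rV[R]_m) a b :
  f t @[t --> F] --> a -> g t @[t --> F] --> b ->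
  dot (f t) (g t) @[t --> F] --> dot a b.
Proof.
move=> fa gb; apply: (@cvg_sumr T _ F FF _ _ (fun i t => f t ord0 i * g t ord0 i)) => i _.
apply: cvgM.
  exact: (cvg_comp f (fun M => M ord0 i) fa (@coord_continuous _ _ _ _ _ a)).
exact: (cvg_comp g (fun M => M ord0 i) gb (@coord_continuous _ _ _ _ _ b)).
Qed.

Lemma dot_continuous y : continuous (fun x => dot x y).
Proof. by move=> x; apply: (@dot_cvg _ _ (nbhs_filter x) id (cst y) x y); [exact: cvg_id|exact: cvg_cst]. Qed.

Lemma dotxx_continuous : continuous (fun x => dot x x).
Proof. by move=> x; apply: (@dot_cvg _ _ (nbhs_filter x) id id x x); exact: cvg_id. Qed.

End Dot.

Section Cap.
Variables (R : realType) (d : nat).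
Implicit Types (x y z c a : 'rV[R]_d.+1).

Lemma sphere_dot_le1 x y : @sphere R d x -> @sphere R d y -> -1 <= dot x y <= 1.
Proof.
rewrite /sphere /= => xx yy; rewrite -ler_norml -(@expr_le1 _ 2)// real_normK ?num_real//.
by apply: le_trans (dot_CS x y) _; rewrite xx yy mulr1.
Qed.

Lemma capE c (rho : R) x : @sphere R d c -> 0 < rho -> rho < pi / 2 ->
  @sphere R d x -> (sdist c x <= rho) = (cos rho <= dot c x).
Proof.
move=> cs r0 r1 xs; have h := sphere_dot_le1 cs xs.
have pp := pi_gt0 R.
rewrite /sdist -{2}(acosK (x := dot c x)) ?in_itv//=.
rewrite -[LHS]negbK -[RHS]negbK -!ltNge; congr (~~ _).
have h1 : acos (dot c x) \in `[0, pi]%R by rewrite in_itv/= acos_ge0// acos_lepi.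
have h2 : rho \in `[0, pi]%R by rewrite in_itv/=; apply/andP; split; lra.
by rewrite ltr_cos.
Qed.

(* The point of the hyperboloid over [z] is [(z, height z)]; it is the image of
   the apex under the Lorentz reflection that restricts to [boost z]. *)
Definition height z : R := Num.sqrt (1 + dot z z).

(** The reflection is applied to the light vector [(x, 1)] and the space part of the image is
    divided by its time part [height z - dot x z]. At [z = 0] the division by zero is harmless,
    being multiplied by [z], and the map is the identity. *)
Definition boost z : 'rV[R]_d.+1 -> 'rV[R]_d.+1 :=
  fun x => (height z - dot x z)^-1 *: (x + z - (dot x z / (height z - 1)) *: z).

Lemma height_sq z : height z ^+ 2 = 1 + dot z z.
Proof. by rewrite sqr_sqrtr// addr_ge0// dot_ge0. Qed.

Lemma height_ge1 z : 1 <= height z.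
Proof. by rewrite -{1}sqrtr1 ler_sqrt ?lerDl ?dot_ge0// addr_ge0// dot_ge0. Qed.

Lemma height_gt0 z : 0 < height z.
Proof. exact: lt_le_trans ltr01 (height_ge1 z). Qed.

Lemma height_gt1 z : z != 0 -> 1 < height z.
Proof. by move=> z0; rewrite -{1}sqrtr1 ltr_sqrt ?ltrDl ?dot_gt0// addr_gt0// dot_gt0. Qed.

Lemma height_dot z x : @sphere R d x -> 0 < height z - dot x z.
Proof.
move=> xs; rewrite subr_gt0; apply: le_lt_trans (dot_le_norm _ _) _.
rewrite xs sqrtr1 mul1r ltr_sqrt ?ltrDr//.
by rewrite ltr_pwDl// dot_ge0.
Qed.

(** For [z != 0] this is a single inversion with center [z / (height z - 1)]; the radius is forced
    by orthogonality to the unit sphere. *)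
Lemma moebius_boost z : moebius (boost z).
Proof.
have [->|z0] := eqVneq z 0.
  apply: MoebiusId => x _.
  by rewrite /boost !dot0r /height dot0r addr0 sqrtr1 subr0 invr1 scale1r scaler0 subr0 addr0.
have h1 := height_gt1 z0.
have h2 := height_sq z.
have m0 : 0 < height z - 1 by rewrite subr_gt0.
pose P := (height z - 1)^-1 *: z.
pose r := Num.sqrt (2 / (height z - 1)).
have r0 : 0 < r by rewrite sqrtr_gt0 divr_gt0.
have r2 : r ^+ 2 = 2 / (height z - 1) by rewrite sqr_sqrtr// divr_ge0 ?ltW.
have Pr : dot P P = 1 + r ^+ 2.
  rewrite r2 /P dotZl dotZr.
  have -> : dot z z = height z ^+ 2 - 1 by rewrite h2; ring.
  by field; rewrite gt_eqF.
apply: (@MoebiusComp R d id (sphere_inversion P r)); first exact: MoebiusId.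
  exact: SmallInversion.
move=> x xs; have hx := height_dot z xs.
rewrite /sphere_inversion.
have -> : dot (x - P) (x - P) = r ^+ 2 * (height z - dot x z).
  rewrite !(dotDl, dotDr, dotNl, dotNr) Pr xs (dotC P) r2 /P dotZr.
  by field; rewrite gt_eqF.
have -> : r ^+ 2 / (r ^+ 2 * (height z - dot x z)) = (height z - dot x z)^-1.
  by field; rewrite !gt_eqF.
rewrite /boost /P; apply/rowP => i; rewrite !mxE.
by field; rewrite !gt_eqF.
Qed.

(* [(slope c rho, slope0 rho)] is the unit spacelike Lorentz normal of the cap
   with center [c] and radius [rho]; [lin] is the sinh of the signed hyperbolic
   distance from the hyperboloid point over [z] to the hyperplane it bounds. *)
Definition slope c (rho : R) : 'rV[R]_d.+1 := (sin rho)^-1 *: c.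
Definition slope0 (rho : R) : R := cos rho / sin rho.

Definition lin a (A : R) z : R := A * height z - dot a z.

(** The space part of the image of [(a, A)] under the Lorentz reflection that exchanges the apex and
    the point over [z]; the time part is [lin a A z]. *)
Definition boost_normal a (A : R) z : 'rV[R]_d.+1 :=
  a - (dot a z / (height z - 1)) *: z + A *: z.

Section Boost.
Variables (z c : 'rV[R]_d.+1) (rho : R).
Hypotheses (cs : @sphere R d c) (rho_gt0 : 0 < rho) (rho_lt : rho < pi / 2).

Lemma sin_rho_gt0 : 0 < sin rho.
Proof. by rewrite sin_gt0_pihalf// rho_gt0. Qed.

Lemma cos_rho_gt0 : 0 < cos rho.
Proof. by rewrite cos_gt0_pihalf// rho_lt andbT (lt_trans _ rho_gt0)// oppr_lt0 divr_gt0// pi_gt0. Qed.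

Lemma slope0_gt0 : 0 < slope0 rho.
Proof. by rewrite divr_gt0 ?sin_rho_gt0 ?cos_rho_gt0. Qed.

Lemma slope_sq : dot (slope c rho) (slope c rho) = 1 + slope0 rho ^+ 2.
Proof.
rewrite /slope dotZl dotZr cs /slope0 exprMn cos2sin2 exprVn.
by field; rewrite gt_eqF ?sin_rho_gt0.
Qed.

Lemma dotzz : dot z z = height z ^+ 2 - 1.
Proof. by rewrite height_sq addrC addKr. Qed.

Lemma boost_sphere x : @sphere R d x -> @sphere R d (boost z x).
Proof.
move=> xs; have hx := height_dot z xs.
rewrite /sphere /= /boost !dotE xs dotzz (dotC z x).
have [z0|/height_gt1 h1] := eqVneq z 0.
  rewrite z0 !dot0r /height dot0r addr0 sqrtr1.
  by rewrite !(mul0r, subr0, addr0, mulr0); field.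
by field; rewrite !gt_eqF// subr_gt0.
Qed.

Lemma boostK x : @sphere R d x -> boost z (boost z x) = x.
Proof.
move=> xs; have hx := height_dot z xs.
have [z0|/height_gt1 h1] := eqVneq z 0.
  have b0 y : boost z y = y.
    by rewrite /boost z0 !dot0r /height dot0r addr0 sqrtr1 subr0 invr1 scale1r scaler0 subr0 addr0.
  by rewrite !b0.
have e : height z - dot (boost z x) z = (height z - dot x z)^-1.
  rewrite /boost !dotE dotzz.
  by field; rewrite !gt_eqF// subr_gt0.
have e2 : dot (boost z x) z = height z - (height z - dot x z)^-1 by rewrite -e; ring.
rewrite {1}/boost e invrK e2 /boost; apply/rowP => i; rewrite !mxE.
by field; rewrite !gt_eqF// subr_gt0.
Qed.

(** Invariance of the Lorentz product of the cap's normal with the light vector [(x, 1)]. The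
    denominator is the positive time part of the image of [(x, 1)], so signs, hence sides of the cap
    boundary, are kept. *)
Lemma boost_normal_dot x : @sphere R d x ->
  dot (boost_normal (slope c rho) (slope0 rho) z) (boost z x) - lin (slope c rho) (slope0 rho) z =
    (dot (slope c rho) x - slope0 rho) / (height z - dot x z).
Proof.
move=> xs; have hx := height_dot z xs.
rewrite /boost_normal /lin; move: (slope c rho) (slope0 rho) => s s0.
rewrite /boost !dotE dotzz (dotC z x).
have [z0|/height_gt1 h1] := eqVneq z 0.
  rewrite z0 !dot0r /height dot0r addr0 sqrtr1.
  by rewrite !(mul0r, subr0, addr0, mulr0); field.

by field; rewrite !gt_eqF// subr_gt0.
Qed.

Lemma boost_normal_sq :
  dot (boost_normal (slope c rho) (slope0 rho) z) (boost_normal (slope c rho) (slope0 rho) z) = 1 + lin (slope c rho) (slope0 rho) z ^+ 2.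
Proof.
have := slope_sq; rewrite /boost_normal /lin; move: (slope c rho) (slope0 rho) => s s0 ss.
rewrite !dotE ss dotzz (dotC z s).
have [z0|/height_gt1 h1] := eqVneq z 0.
  rewrite z0 !dot0r /height dot0r addr0 sqrtr1.
  by ring.
by field; rewrite !gt_eqF// subr_gt0.
Qed.

(** The new normal has time part [L], so the new radius has cotangent [L], and [L > 0] keeps it
    below [pi / 2]. The factor [sin rho'] normalizes a vector of square length [1 + L ^+ 2]. *)
Lemma boost_cap : 0 < lin (slope c rho) (slope0 rho) z ->
  let rho' := pi / 2 - atan (lin (slope c rho) (slope0 rho) z) in
  is_cap (boost z @` [set x | @sphere R d x /\ sdist c x <= rho])
    (sin rho' *: boost_normal (slope c rho) (slope0 rho) z) rho'.
Proof.
move=> L0 rho'; set L := lin (slope c rho) (slope0 rho) z in L0 rho' *.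
have a0 : 0 < atan L by rewrite -(atan0 R) lt_atan.
have a1 := atan_ltpi2 L.
have r0 : 0 < rho' by rewrite subr_gt0.
have r1 : rho' < pi / 2 by rewrite /rho' ltrBlDr ltrDl.
have cE : cos rho' = L * cos (atan L).
  rewrite /rho' cosB cos_pihalf sin_pihalf mul0r add0r mul1r.
  have c0 : cos (atan L) != 0.
    by rewrite gt_eqF// cos_atan invr_gt0 sqrtr_gt0 ltr_pwDl// sqr_ge0.
  have := atanK L; rewrite /tan => /(congr1 ( *%R^~ (cos (atan L)))).
  by rewrite mulfVK.
have sE : sin rho' = cos (atan L).
  by rewrite /rho' sinB cos_pihalf sin_pihalf mul0r subr0 mul1r.
have s0 : 0 < sin rho' by rewrite sin_gt0_pihalf// r0.
have cs1 : @sphere R d (sin rho' *: boost_normal (slope c rho) (slope0 rho) z).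
  rewrite /sphere /= dotZl dotZr boost_normal_sq -/L sE cos_atan mulrA -invfM -expr2.
  have L1 : 0 < 1 + L ^+ 2 by rewrite ltr_pwDl// sqr_ge0.
  by rewrite sqr_sqrtr ?ltW// mulVf// gt_eqF.
have key x : @sphere R d x -> (sdist c x <= rho) =
    (sdist (sin rho' *: boost_normal (slope c rho) (slope0 rho) z) (boost z x) <= rho').
  move=> xs; have bs := boost_sphere xs; rewrite (capE cs rho_gt0 rho_lt xs) (capE cs1 r0 r1 bs).
  rewrite cE -sE mulrC dotZl ler_pM2l//.
  rewrite -(subr_ge0 L) boost_normal_dot//.
  rewrite pmulr_lge0 ?invr_gt0 ?height_dot// subr_ge0 /slope /slope0 dotZl.
  by rewrite ler_pdivrMr ?sin_rho_gt0// mulrAC mulVf ?mul1r// gt_eqF// sin_rho_gt0.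
split => //; apply/seteqP; split => [_ [x [xs xr] <-]|y [ys yr]] /=.
  by split; [exact: boost_sphere|rewrite -key].
exists (boost z y); last exact: boostK.
split; first exact: boost_sphere.
by rewrite key ?boostK//; exact: boost_sphere.
Qed.

End Boost.
End Cap.

(** * Interior, boundary and connectedness of caps *)

Section CapTopology.
Variables (R : realType) (d : nat).
Implicit Types (x y z u c : 'rV[R]_d.+1).

Definition normalize u : 'rV[R]_d.+1 := (Num.sqrt (dot u u))^-1 *: u.

Lemma normalize_sphere u : u != 0 -> @sphere R d (normalize u).
Proof.
move=> /dot_gt0 u0; rewrite /sphere /= !dotE mulrA -invfM -expr2 sqr_sqrtr ?ltW//.
by rewrite mulVf// gt_eqF.
Qed.

Lemma normalize_id u : @sphere R d u -> normalize u = u.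
Proof. by rewrite /normalize => ->; rewrite sqrtr1 invr1 scale1r. Qed.

Lemma normalize_cvg (T : Type) (F : set_system T) (FF : Filter F) (f : T -> 'rV[R]_d.+1) u :
  u != 0 -> f t @[t --> F] --> u -> normalize (f t) @[t --> F] --> normalize u.
Proof.
move=> u0 fu; apply: cvgZ => //; apply: cvgV.
  by rewrite gt_eqF// sqrtr_gt0 dot_gt0.
apply: (cvg_comp (fun t => dot (f t) (f t)) Num.sqrt (G := nbhs (dot u u))).
  exact: dot_cvg.
exact: sqrt_continuous.
Qed.

Lemma sphere_neq0 x : @sphere R d x -> x != 0.
Proof. by move=> xs; rewrite -dot_eq0 xs oner_eq0. Qed.

Lemma nbhs_subspace_sphere x (B : set 'rV[R]_d.+1) : @sphere R d x ->
  @nbhs _ (subspace (@sphere R d)) x B <-> nbhs x [set y | @sphere R d y -> B y].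
Proof. by move=> xs; rewrite {1}/nbhs /= -nbhs_subspace_in. Qed.

Section OneCap.
Variables (A : set 'rV[R]_d.+1) (c : 'rV[R]_d.+1) (rho : R).
Hypothesis capA : is_cap A c rho.

Let cs : @sphere R d c. Proof. by case: capA. Qed.
Let r0 : 0 < rho. Proof. by case: capA. Qed.
Let r1 : rho < pi / 2. Proof. by case: capA. Qed.

Let AE x : A x <-> @sphere R d x /\ cos rho <= dot c x.
Proof.
case: capA => _ _ _ -> /=.
by split=> -[xs]; rewrite capE.
Qed.

Let k0 : 0 < cos rho. Proof. exact: cos_rho_gt0. Qed.
Let k1 : cos rho < 1.
Proof.
rewrite -(cos0 R) ltr_cos ?in_itv//= ?lexx ?pi_ge0//.
by rewrite ltW//= (le_trans (ltW r1))// ler_pdivrMr// ler_peMr ?pi_ge0// ler1n.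
Qed.

(** Moving from [x] against the center and projecting back to the sphere leaves the cap at once. *)
Lemma exit_cap x : @sphere R d x -> dot c x = cos rho ->
  ~ nbhs x [set y | @sphere R d y -> A y].
Proof.
move=> xs xc nA.
have hc : (fun t : R => normalize (x - t *: c)) @ 0^'+ --> x.
  rewrite -[X in _ --> X](normalize_id xs); apply: normalize_cvg; first exact: sphere_neq0.
  have : (fun t : R => x - t *: c) @ 0^'+ --> x - 0 *: c.
    apply: cvgB; first exact: cvg_cst.
    by apply: cvgZr_tmp; apply: cvg_at_right_filter; exact: cvg_id.
  by rewrite scale0r subr0.
have hU := hc _ nA.
have : \forall t \near (0 : R)^'+,
    (@sphere R d (normalize (x - t *: c)) -> A (normalize (x - t *: c))) /\ (0 < t < cos rho).
  near=> t; split; first by near: t; exact: hU.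
  apply/andP; split; first by near: t; exact: nbhs_right_gt.
  by near: t; exact: nbhs_right_lt.
move=> /filter_ex [t [+ /andP[t0 tk]]].
set y := x - t *: c.
have yy : dot y y = 1 - 2 * t * cos rho + t ^+ 2.
  by rewrite /y !dotE xs cs (dotC x c) xc; ring.
have cy : dot c y = cos rho - t by rewrite /y !dotE xc cs; ring.
have y0 : y != 0.
  by apply: contraTneq tk => y0; move: cy; rewrite y0 dot0r => /eqP; rewrite eq_sym subr_eq0 => /eqP ->; rewrite ltxx.
move=> /(_ (normalize_sphere y0)) /AE [_].
have sy : 0 < Num.sqrt (dot y y) by rewrite sqrtr_gt0 dot_gt0.
rewrite /normalize dotZr cy mulrC ler_pdivlMr// leNgt => /negP; apply.
rewrite -(@ltr_pXn2r _ 2%N) ?nnegrE ?subr_ge0 ?mulr_ge0 ?ltW//.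
rewrite exprMn sqr_sqrtr ?dot_ge0// yy.
rewrite -subr_gt0.
have -> : cos rho ^+ 2 * (1 - 2 * t * cos rho + t ^+ 2) - (cos rho - t) ^+ 2 =
  t * (1 - cos rho ^+ 2) * (2 * cos rho - t) by ring.
rewrite !mulr_gt0//; last lra.
by rewrite subr_gt0 expr_lt1// ltW.
Unshelve. all: by end_near. Qed.

Lemma cap_sinterior : sinterior A = [set x | @sphere R d x /\ cos rho < dot c x].
Proof.
apply/seteqP; split=> x; rewrite /sinterior.
  move=> Ax; have /AE [xs xc] := interior_subset Ax.
  split=> //; rewrite lt_neqAle xc andbT; apply/eqP => e.
  by move: Ax => /(nbhs_subspace_sphere _ xs); exact: exit_cap.
move=> [xs xc]; apply/(nbhs_subspace_sphere _ xs).
have op : open [set y | cos rho < dot y c].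
  by have /continuousP := @dot_continuous R d.+1 c; move=> /(_ _ (@open_gt _ (cos rho))).
have : nbhs x [set y | cos rho < dot y c].
  by apply: open_nbhs_nbhs; split; [exact: op|rewrite /= dotC].
by apply: filterS => y /= yc ys; apply/AE; rewrite dotC ltW.
Qed.

Lemma cap_sboundary : sboundary A = [set x | @sphere R d x /\ dot c x = cos rho].
Proof.
have clA : @closure (subspace (@sphere R d)) A = A.
  apply/seteqP; split; last exact: (@subset_closure (subspace (@sphere R d)) A).
  move=> x clx; have [xs|xs] := pselect (@sphere R d x); last first.
    have : @nbhs _ (subspace (@sphere R d)) x [set x].
      by rewrite /nbhs /= -nbhs_subspace_out.
    by move=> /clx [y [Ay /= yx]]; rewrite -yx.
  apply/AE; split=> //; rewrite leNgt; apply/negP => xc.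
  have op : open [set y | dot y c < cos rho].
    by have /continuousP := @dot_continuous R d.+1 c; move=> /(_ _ (@open_lt _ (cos rho))).
  have nx : @nbhs _ 'rV[R]_d.+1 x [set y | dot y c < cos rho].
    by apply: open_nbhs_nbhs; split; [exact: op|rewrite /= dotC].
  have : @nbhs _ (subspace (@sphere R d)) x [set y | dot y c < cos rho].
    by apply/(nbhs_subspace_sphere _ xs); apply: filterS nx => y yc _.
  by move=> /clx [y [/AE [_ yc] /=]]; rewrite dotC ltNge yc.
rewrite /sboundary clA -/(sinterior A) cap_sinterior.
apply/seteqP; split=> x /=.
  move=> [/AE [xs xc] h]; split=> //; apply/eqP; rewrite eq_sym eq_le xc /= leNgt.
  by apply/negP => h'; apply: h.
move=> [xs xc]; split; first by apply/AE; rewrite xc.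
by move=> [_]; rewrite xc ltxx.
Qed.

(** The open cap is star-shaped about its center: along the segment from [c] to [x] the inner
    product with [c] stays above [cos rho > 0], so the segment avoids the origin and can be
    projected radially. *)
Lemma cap_sinterior_connected : connected (sinterior A).
Proof.
rewrite cap_sinterior.
pose path x (t : R) := normalize (c + t *: (x - c)).
have E : [set x | @sphere R d x /\ cos rho < dot c x] =
    \bigcup_(x in [set x | @sphere R d x /\ cos rho < dot c x]) (path x @` `[0, 1]).
  apply/seteqP; split=> [x [xs xc]|_ [x [xs xc] [t + <-]]].
    exists x => //; exists 1; first by rewrite /= in_itv/= lexx ler01.
    by rewrite /path scale1r addrC subrK normalize_id.
  rewrite /= in_itv/= => /andP[t0 t1]; rewrite /path; set u := c + _.
  have cu : dot c u = 1 - t + t * dot c x by rewrite /u !dotE cs; ring.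
  have /andP[_ x1] := sphere_dot_le1 cs xs.
  have uc : cos rho < dot c u.
    by rewrite cu; nra.
  have uu : dot u u <= 1.
    have -> : dot u u = (1 - t) ^+ 2 + t ^+ 2 + 2 * t * (1 - t) * dot c x.
      by rewrite /u !dotE cs xs (dotC x c); ring.
    have : 0 <= t * (1 - t) * (1 - dot c x) by rewrite !mulr_ge0// subr_ge0.
    by nra.
  have u0 : u != 0.
    by apply: contraTneq uc => ->; rewrite dot0r -leNgt ltW.
  split; first exact: normalize_sphere.
  have su : 0 < Num.sqrt (dot u u) by rewrite sqrtr_gt0 dot_gt0.
  rewrite /normalize dotZr mulrC ltr_pdivlMr//; apply: le_lt_trans uc.
  by rewrite ler_piMr ?(ltW k0)// -sqrtr1 ler_sqrt.
rewrite E; apply: bigcup_connected.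
  exists c => x [xs xc]; exists 0; first by rewrite /= in_itv/= lexx ler01.
  by rewrite /path scale0r addr0 normalize_id.
move=> x [xs xc]; apply: connected_continuous_connected; first exact: segment_connected.
apply: continuous_in_subspaceT => t /set_mem; rewrite /= in_itv/= => /andP[t0 t1].
apply: normalize_cvg.
  have cu : dot c (c + t *: (x - c)) = 1 - t + t * dot c x by rewrite !dotE cs; ring.
  have : 0 < dot c (c + t *: (x - c)) by rewrite cu; have := k0; nra.
  by apply: contraTneq => ->; rewrite dot0r ltxx.
apply: cvgD; first exact: cvg_cst.
by apply: cvgZr_tmp; exact: cvg_id.
Qed.

End OneCap.

(* If both values were negative, the point [z / height z] of the unit ball would
   lie in the convex hulls of both caps, and their interiors would meet. *)
Lemma caps_split n (C : 'I_n -> set 'rV[R]_d.+1) (c : 'I_n -> 'rV[R]_d.+1)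
    (rho : 'I_n -> R) :
  (forall i, is_cap (C i) (c i) (rho i)) ->
  ~ connected (\bigcup_(i in [set: 'I_n]) sinterior (C i)) ->
  exists A : pred 'I_n, [/\ exists i, A i, exists i, ~~ A i
    & forall i j z, A i -> ~~ A j -> 0 <= lin (slope (c i) (rho i)) (slope0 (rho i)) z \/
        0 <= lin (slope (c j) (rho j)) (slope0 (rho j)) z].
Proof.
move=> hC /connectedPn [E [E0 EU sE]].
have sub i : sinterior (C i) `<=` E false \/ sinterior (C i) `<=` E true.
  apply: connected_subset sE _ (cap_sinterior_connected (hC i)).
  by rewrite -EU => x Cx; exists i.
have nI x : E false x -> E true x -> False.
  by move=> x1 x2; have := separated_disjoint sE; rewrite -subset0 => /(_ x); apply.
pose A i := `[< sinterior (C i) `<=` E true >].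
have An i : ~~ A i -> sinterior (C i) `<=` E false.
  by move/asboolPn; case: (sub i).
have ex b : exists i, sinterior (C i) `&` E b !=set0.
  have [x Ex] := E0 b; have : (E false `|` E true) x by case: b Ex; [right|left].
  by rewrite -EU => -[i _ Cx]; exists i, x.
exists A; split.
- have [i [x [Cx Ex]]] := ex true; exists i; apply/asboolP.
  by case: (sub i) => // /(_ _ Cx) /nI; case.
- have [i [x [Cx Ex]]] := ex false; exists i; apply/asboolPn => /(_ _ Cx).
  exact: nI.
move=> i j z /asboolP Ai /An Aj.
have [_|li] := leP 0 (lin (slope (c i) (rho i)) (slope0 (rho i)) z); first by left.
have [_|lj] := leP 0 (lin (slope (c j) (rho j)) (slope0 (rho j)) z); first by right.
exfalso.
have H0 := height_gt0 z.
have [x xE] : exists x, x = (height z)^-1 *: z by exists ((height z)^-1 *: z).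
have lx k : lin (slope (c k) (rho k)) (slope0 (rho k)) z < 0 -> cos (rho k) < dot (c k) x.
  have [cs r0 r1 _] := hC k.
  have s0 : 0 < sin (rho k) by exact: sin_rho_gt0.
  rewrite /lin /slope /slope0 dotZl subr_lt0 mulrAC ltr_pdivrMr// mulrAC mulVf ?gt_eqF// mul1r.
  by rewrite xE [dot _ (_ *: _)]dotZr [_^-1 * _]mulrC ltr_pdivlMr.
have xx : dot x x < 1.
  rewrite xE !dotE mulrA -invfM -expr2 mulrC ltr_pdivrMr ?exprn_gt0// mul1r height_sq.
  by rewrite ltrDr.
have [ci ri0 ri1 _] := hC i; have [cj rj0 rj1 _] := hC j.
have ki : 0 < cos (rho i) by exact: cos_rho_gt0.
have kj : 0 < cos (rho j) by exact: cos_rho_gt0.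
have hi := lx _ li; have hj := lx _ lj.
have [v vE] : exists v, v = c i + c j by exists (c i + c j).
have v0 : v != 0.
  apply/eqP => v0; have : dot v x = 0 by rewrite v0 dot0l.
  by rewrite vE dotDl; lra.
have vv := dot_gt0 v0.
pose b := dot x v; pose e := 1 - dot x x.
pose s := (Num.sqrt (b ^+ 2 + dot v v * e) - b) / dot v v.
have e0 : 0 < e by rewrite subr_gt0.
have D0 : 0 <= b ^+ 2 + dot v v * e by rewrite addr_ge0 ?sqr_ge0// mulr_ge0// ltW.
have s0 : 0 <= s.
  apply: divr_ge0; last exact: ltW.
  rewrite subr_ge0; apply: le_trans (ler_norm _) _.
  by rewrite -sqrtr_sqr ler_sqrt// lerDl mulr_ge0// ltW.
have ys : @sphere R d (x + s *: v).
  rewrite /sphere /= !(dotDl, dotDr, dotZl, dotZr) (dotC v x) -/b.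
  have se : s * dot v v = Num.sqrt (b ^+ 2 + dot v v * e) - b by rewrite /s mulfVK// gt_eqF.
  have : dot v v * (dot x x + s * b + s * (b + s * dot v v)) = dot v v * 1.
    have -> : dot v v * (dot x x + s * b + s * (b + s * dot v v)) =
      dot v v * dot x x + 2 * b * (s * dot v v) + (s * dot v v) ^+ 2 by ring.
    have := sqr_sqrtr D0; rewrite se /e => q.
    set Q := Num.sqrt _ in q *.
    have -> : dot v v * dot x x + 2 * b * (Q - b) + (Q - b) ^+ 2 = dot v v * dot x x - b ^+ 2 + Q ^+ 2 by ring.
    by rewrite q; ring.
  by move=> h; rewrite -(mulfI (lt0r_neq0 vv) h); ring.
have /andP[cc _] := sphere_dot_le1 ci cj.
have yi : sinterior (C i) (x + s *: v).
  rewrite (cap_sinterior (hC i)); split=> //; rewrite vE !dotE ci.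
  by nra.
have yj : sinterior (C j) (x + s *: v).
  rewrite (cap_sinterior (hC j)); split=> //; rewrite vE !dotE cj (dotC (c j) (c i)).
  by nra.
by apply: (nI _ (Aj _ yj)); exact: Ai.
Qed.

End CapTopology.

(** * Truncated potentials *)

Section Antiderivative.
Variable R : realType.
Implicit Types (F G f g : R -> R) (a b x t : R).

Lemma is_derive_continuous F x (l : R) : is_derive x 1 F l -> {for x, continuous F}.
Proof. by move=> [dF _]; apply: differentiable_continuous; exact/derivable1_diffP. Qed.

Lemma is_derive_within F f a b : (forall x, a <= x <= b -> is_derive x 1 F (f x)) ->
  {within `[a, b], continuous F}.
Proof.
move=> h; apply: continuous_in_subspaceT => x /set_mem; rewrite /= in_itv/= => /h.
exact: is_derive_continuous.
Qed.

Lemma incr_le F G f g a b : a <= b ->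
  (forall x, a <= x <= b -> is_derive x 1 F (f x)) ->
  (forall x, a <= x <= b -> is_derive x 1 G (g x)) ->
  (forall x, a <= x <= b -> f x <= g x) -> F b - F a <= G b - G a.
Proof.
move=> ab dF dG fg.
have dH x : a <= x <= b -> is_derive x 1 (G - F) (g x - f x).
  by move=> xab; apply: is_deriveB; [exact: dG|exact: dF].
have [|c] := @MVT_segment R (G - F) (fun x => g x - f x) a b ab _ (is_derive_within dH).
  by move=> x; rewrite in_itv/= => /andP[ax xb]; apply: dH; rewrite !ltW.
rewrite in_itv/= => /fg cab; rewrite -[_ b]/(G b - F b) -[_ a]/(G a - F a) => e.
have : 0 <= (g c - f c) * (b - a) by rewrite mulr_ge0 ?subr_ge0.
by rewrite -e; lra.
Qed.

Lemma is_deriveMid (c : R) x : is_derive x 1 (fun t => c * t) c.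
Proof.
have -> : (fun t : R => c * t) = c *: (id : R -> R) by apply/funext.
by apply: is_derive_eq; rewrite /= [_ *: _]mulr1.
Qed.

(** Integrals from [- n] are primitives to the right of [- n]; normalized at [0] they agree where
    both are valid. Near [x] a single index, that of [|x| + 1], serves all points. *)
Lemma antiderivative f : continuous f -> exists F, forall x, is_derive x 1 F (f x).
Proof.
move=> cf.
pose P (n : nat) x := (\int[lebesgue_measure]_(t in `[(- n%:R)%R, x]) f t)%R.
have dP n x : - n%:R < x -> is_derive x 1 (P n) (f x).
  move=> nx; have xu : x < x + 1 by rewrite ltrDl.
  have fi : (@lebesgue_measure R).-integrable `[- n%:R, x + 1] (EFin \o f).
    apply: continuous_compact_integrable; first exact: segment_compact.
    exact: continuous_subspaceT.
  have [dF Fe] := continuous_FTC1_closed xu fi nx (cf x).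
  by split; [exact: dF|rewrite -derive1E; exact: Fe].
pose N x : nat := (Num.truncn `|x|).+1.
have N1 x : `|x| < (N x)%:R by rewrite /N truncnS_gt.
pose Q n x := P n x - P n 0.
have dQ n x : - n%:R < x -> is_derive x 1 (Q n) (f x).
  move=> nx; rewrite -(subr0 (f x)).
  by apply: is_deriveB; exact: dP.
have Qeq n p x : `|x| < n%:R -> (n <= p)%N -> (0 < n)%N -> Q n x = Q p x.
  rewrite ltr_norml => /andP[x1 x2] np n0.
  have np' : - p%:R <= - n%:R :> R by rewrite lerN2 ler_nat.
  have n0' : - n%:R < 0 :> R by rewrite oppr_lt0 ltr0n.
  have Q0 k : Q k 0 = 0 by rewrite /Q subrr.
  have [x0|x0] := leP 0 x.
    have H : forall k l : nat, - k%:R < 0 :> R -> - l%:R < 0 :> R -> Q k x <= Q l x.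
      move=> k l k0 l0.
      have := @incr_le (Q k) (Q l) f f 0 x x0 _ _ (fun _ _ => lexx _).
      rewrite !Q0 !subr0; apply=> y /andP[y0 _]; apply: dQ; lra.
    by apply/eqP; rewrite eq_le !H//; lra.
  have H : forall k l : nat, - k%:R < x -> - l%:R < x -> Q k x <= Q l x.
    move=> k l k0 l0.
    have := @incr_le (Q l) (Q k) f f x 0 (ltW x0) _ _ (fun _ _ => lexx _).
    rewrite !Q0 !sub0r lerN2; apply=> y /andP[y0 _]; apply: dQ; lra.
  by apply/eqP; rewrite eq_le !H//; lra.
exists (fun x => Q (N x) x) => x.
apply: (@near_eq_is_derive _ _ _ (Q (N (`|x| + 1)))); last first.
  apply: dQ; have := N1 (`|x| + 1); rewrite ger0_norm; last by rewrite addr_ge0.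
  by have := ler_norm (- x); rewrite normrN; lra.
near=> y; symmetry; apply: Qeq => //.
rewrite /N ltnS; apply: le_truncn.
rewrite [`|_ + _|]ger0_norm ?addr_ge0//.
have : `|y - x| < 1.
  by rewrite distrC; near: y; exact: (@cvgr_dist_lt _ _ _ _ _ id).
have := ler_normD (y - x) x; rewrite subrK; lra.
Unshelve. all: by end_near. Qed.

End Antiderivative.

Section Truncation.
Variables (R : realType) (phi : R -> R) (K : R).
Hypothesis phi_cont : forall t, 0 < t -> {for t, continuous phi}.
Hypothesis phi_gt0 : forall t, 0 < t -> 0 < phi t.
Hypothesis phi_pinfty : forall M, exists2 e, 0 < e & forall t, 0 < t -> t < e -> M < phi t.
Hypothesis phi_le : forall t, 0 < t -> t <= 1 -> t * phi t <= K.

(** The substitution [t = expR x] turns the half-line into the whole line. *)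
Lemma positive_antiderivative :
  exists2 h : R -> R, h 1 = 0 & forall t : R, 0 < t -> is_derive t 1 h (phi t).
Proof.
pose u x := expR x * phi (expR x).
have cu : continuous u.
  move=> x; apply: cvgM; first exact: continuous_expR.
  apply: (cvg_comp expR phi (G := nbhs (expR x))); first exact: continuous_expR.
  by apply: phi_cont; exact: expR_gt0.
have [V dV] := antiderivative cu.
exists (fun t => V (ln t) - V 0); first by rewrite ln1 subrr.
move=> t t0; rewrite -(subr0 (phi t)); apply: is_deriveB.
apply: (is_derive_eq (is_derive1_comp (dV (ln t)) (is_derive1_ln t0))).
by rewrite /u lnK ?posrE// mulrAC divff ?mul1r// gt_eqF.
Qed.

(* [psi] is [phi], cut off at [k / t] for large [t] and frozen at the value
   [k ^ 2] below [s]; [e] is an antiderivative of [psi]. *)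
Record truncated (h : R -> R) (k : R) (psi e : R -> R) (s : R) : Prop := Truncated {
  tr_cont : continuous psi;
  tr_gt0 : forall t, 0 < psi t;
  tr_derive : forall t : R, is_derive t 1 e (psi t);
  tr_e1 : e 1 = 0;
  tr_le : forall t, t * psi t <= k;
  tr_leK : forall t, t <= 1 -> t * psi t <= K;
  tr_low : forall t, t <= s -> psi t = k ^+ 2;
  tr_eq : forall t, s <= t -> t * psi t < k -> psi t = phi t;
  tr_s0 : 0 < s;
  tr_min : forall t, 1 <= t -> psi t = Num.min (phi t) (k / t);
  tr_lower : forall t D, 0 <= D -> - D <= k ^+ 2 * t -> h (k ^+ 2)^-1 - 1 - K - D <= e t;
  tr_upper : forall t, 1 <= t -> e t <= h t }.

Let phi_within a b : 0 < a -> {within `[a, b], continuous phi}.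
Proof.
move=> a0; apply: continuous_in_subspaceT => t /set_mem; rewrite /= in_itv/= => /andP[at_ _].
by apply: phi_cont; exact: lt_le_trans at_.
Qed.

(** Solving [phi s = k] alone would not suffice: the maximality of [h t - k * t] at [s] is what
    later bounds [h s] from below. *)
Lemma contact_point (h : R -> R) (k : R) : 0 < k ->
  (forall t : R, 0 < t -> is_derive t 1 h (phi t)) ->
  (forall t, 1 <= t -> t <= 2 -> phi t < k) ->
  exists s, [/\ 0 < s, s < 1, phi s = k & forall t, 0 < t -> t <= 1 -> h t - k * t <= h s - k * s].
Proof.
move=> k0 dh hk.
have [e e0 he] := phi_pinfty k.
pose a := Num.min e 1.
have a0 : 0 < a by rewrite lt_min e0 ltr01.
have a1 : a <= 1 by rewrite ge_min lexx orbT.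
have ha t : 0 < t -> t < a -> k < phi t.
  by move=> t0 ta; apply: he => //; apply: lt_le_trans ta _; rewrite ge_min lexx.
pose G (t : R) := h t - k * t.
have dG (t : R) : 0 < t -> is_derive t 1 G (phi t - k).
  by move=> t0; apply: is_deriveB; [exact: dh|exact: is_deriveMid].
have wG x y : 0 < x -> {within `[x, y], continuous G}.
  move=> x0; apply: (@is_derive_within _ G (fun t => phi t - k)) => t /andP[xt _].
  by apply: dG; exact: lt_le_trans xt.
have mvt x y : 0 < x -> x < y -> exists2 c, x < c < y & G y - G x = (phi c - k) * (y - x).
  move=> x0 xy; have [|c + ->] := @MVT R G (fun t => phi t - k) x y xy _ (wG x y x0).
    by move=> t; rewrite in_itv/= => /andP[xt _]; apply: dG; exact: lt_trans xt.
  by rewrite in_itv/= => cxy; exists c.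
have a20 : 0 < a / 2 by rewrite divr_gt0.
have a22 : a / 2 <= 2 by lra.
(* The interval is wider than [[a, 1]] on both sides; the signs of [phi - k] outside [[a, 1]] force
   the maximum into it, hence into the interior. *)
have [s] := EVT_max a22 (wG _ 2 a20).
rewrite in_itv/= => /andP[s1 s2] smax.
have s0 : 0 < s by exact: lt_le_trans s1.
have as_ : a <= s.
  rewrite leNgt; apply/negP => sa.
  have [c /andP[sc ca] e1] := mvt s a s0 sa.
  have : 0 < (phi c - k) * (a - s) by rewrite mulr_gt0 ?subr_gt0// ha// (lt_trans s0 sc).
  rewrite -e1 subr_gt0 ltNge smax// in_itv/=; lra.
have s1' : s <= 1.
  rewrite leNgt; apply/negP => sa.
  have [c /andP[sc ca] e1] := mvt 1 s ltr01 sa.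
  have : (phi c - k) * (s - 1) < 0.
    rewrite pmulr_llt0 ?subr_gt0// subr_lt0 hk ?ltW//; exact: lt_le_trans ca s2.
  rewrite -e1 subr_lt0 ltNge smax// in_itv/=; lra.
have phis : phi s = k.
  have D0 : is_derive s 1 G 0.
    apply: (@derive1_at_max R G (a / 2) 2 s a22).
    - move=> t; rewrite in_itv/= => /andP[t0 _].
      by have [] := dG t (lt_trans a20 t0).
    - by rewrite in_itv/=; lra.
    - move=> t; rewrite in_itv/= => /andP[t1 t2]; apply: smax.
      by rewrite in_itv/= !ltW.
  have := @derive_val _ _ _ _ _ _ _ D0; have -> := @derive_val _ _ _ _ _ _ _ (dG s s0).
  by move/eqP; rewrite subr_eq0 => /eqP.
exists s; split => //.
  rewrite lt_neqAle s1' andbT; apply/eqP => e1.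
  by have := hk 1 (lexx _) (ler1n R 2); rewrite -[in phi 1]e1 phis ltxx.
move=> t t0 t1; rewrite -/(G t) -/(G s).
have [ta|ta] := ltP t (a / 2); last by apply: smax; rewrite in_itv/=; lra.
have [c /andP[tc ca] e1] := mvt t (a / 2) t0 ta.
have : 0 <= (phi c - k) * (a / 2 - t).
  rewrite mulr_ge0 ?subr_ge0 ?ltW//; apply: ha; first exact: lt_trans tc.
  lra.
rewrite -e1 subr_ge0 => /le_trans; apply; apply: smax; rewrite in_itv/=; lra.
Qed.

Lemma truncation (h : R -> R) : h 1 = 0 -> (forall t : R, 0 < t -> is_derive t 1 h (phi t)) ->
  exists k0, forall k, k0 <= k -> exists psi e s, truncated h k psi e s.
Proof.
move=> h1 dh.
have [c _ hc] := EVT_max (ler1n R 2) (@phi_within 1 2 ltr01).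
exists (Num.max 1 (Num.max K (phi c + 1))) => k; rewrite !ge_max => /and3P[k1 kK kc].
have k0 : 0 < k by exact: lt_le_trans k1.
have kk : k <= k ^+ 2 by rewrite expr2 ler_peMr// ltW.
have k20 : 0 < k ^+ 2 by rewrite exprn_gt0.
have [|s [s0 s1 phis smax]] := @contact_point h (k ^+ 2) k20 dh.
  by move=> t t1 t2; have := hc t; rewrite in_itv/= t1 t2 => /(_ isT); lra.
have sK : s * k ^+ 2 <= K by rewrite -phis; apply: phi_le => //; exact: ltW.
(* At [s] the cap [k / s] is not active, since [s * k ^+ 2 <= K <= k]; hence the value [k ^+ 2] up
   to [s]. *)
pose psi t := Num.min (phi (Num.max t s)) (k / Num.max t s).
have ms t : 0 < Num.max t s by rewrite lt_max s0 orbT.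
have cmax : continuous (fun t : R => Num.max t s).
  by move=> t; apply: (@continuous_max R R id (cst s)); [exact: cvg_id|exact: cst_continuous].
have cpsi : continuous psi.
  move=> t; apply: (@continuous_min R R (fun t => phi (Num.max t s)) (fun t => k / Num.max t s)).
    apply: (cvg_comp (fun t : R => Num.max t s) phi (G := nbhs (Num.max t s))); first exact: cmax.
    exact: phi_cont.
  apply: cvgM; first exact: cvg_cst.
  by apply: cvgV; [rewrite gt_eqF|exact: cmax].
have psi0 t : 0 < psi t by rewrite /psi lt_min phi_gt0//= divr_gt0.
have low t : t <= s -> psi t = k ^+ 2.
  move=> ts; rewrite /psi (max_idPr ts) phis; apply/min_idPl.
  by rewrite ler_pdivlMr// mulrC; apply: le_trans sK _.
have high t : s <= t -> psi t = Num.min (phi t) (k / t).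
  by move=> st; rewrite /psi (max_idPl st).
have psi_phi t : s <= t -> psi t <= phi t by move=> st; rewrite high// ge_min lexx.
have [e' de'] := antiderivative cpsi.
pose e t := e' t - e' 1.
have de (t : R) : is_derive t 1 e (psi t).
  by rewrite -(subr0 (psi t)); apply: is_deriveB.
have e1 : e 1 = 0 by rewrite /e subrr.
have leK t : t <= 1 -> t * psi t <= K.
  move=> t1; have [ts|st] := leP t s.
    rewrite low//; apply: le_trans sK; by rewrite ler_pM2r.
  have t0 : 0 < t by exact: lt_trans st.
  apply: le_trans (phi_le t0 t1); rewrite ler_pM2l//; apply: psi_phi; exact: ltW.
(* Both functions vanish at [1], and [psi <= phi] on [[s, 1]], so [e] drops less than [h] on the way
   down to [s]. *)
have es : h s <= e s.
  have := @incr_le _ e h psi phi s 1 (ltW s1) (fun t _ => de t).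
  rewrite e1 h1 !sub0r lerN2; apply => t /andP[st _]; last exact: psi_phi.
  by apply: dh; exact: lt_le_trans st.
exists psi, e, s; split => //.
- move=> t; have [ts|st] := leP t s.
    rewrite low//; apply: le_trans kK; apply: le_trans sK; by rewrite ler_pM2r.
  have t0 : 0 < t by exact: lt_trans st.
  by rewrite mulrC -ler_pdivlMr// (high _ (ltW st)) ge_min lexx orbT.
- move=> t st; have t0 : 0 < t by exact: lt_le_trans st.
  by rewrite mulrC -ltr_pdivlMr// high// gt_min ltxx orbF => /ltW /min_idPl.
- by move=> t t1; apply: high; apply: le_trans t1; exact: ltW.
- move=> t D D0 tD.
  (* The maximality at [s] is compared with the point [(k ^+ 2)^-1], where the linear term equals
     [1]. *)
  have hs : h (k ^+ 2)^-1 - 1 <= h s.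
    have := smax (k ^+ 2)^-1; rewrite invr_gt0 k20 divff ?gt_eqF// => /(_ isT).
    have i1 : (k ^+ 2)^-1 <= 1 by rewrite invf_le1// (le_trans k1).
    move=> /(_ i1) le1; have : 0 <= k ^+ 2 * s by rewrite mulr_ge0 ?ltW//.
    lra.
  have K0 : 0 <= K by apply: le_trans sK; rewrite mulr_ge0 ?ltW.
  have [st|ts] := leP s t.
    have : e s <= e t.
      have := @incr_le _ (cst 0) e (cst 0) psi s t st.
      rewrite subrr subr_ge0; apply => y _; exact: ltW.
    lra.
  have : e s - e t <= k ^+ 2 * s - k ^+ 2 * t.
    apply: (@incr_le _ e (fun y => k ^+ 2 * y) psi (cst (k ^+ 2)) t s (ltW ts)) => //.
      by move=> y _; exact: is_deriveMid.
    by move=> y /andP[_ ys]; rewrite low.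
  have := sK; rewrite mulrC; lra.
- move=> t t1.
  have := @incr_le _ e h psi phi 1 t t1 (fun y _ => de y).
  rewrite e1 h1 !subr0; apply => y /andP[y1 _]; first by apply: dh; exact: lt_le_trans y1.
  by apply: psi_phi; apply: le_trans y1; exact: ltW.
Qed.

End Truncation.

(** * The weights as functions of the cotangent of the radius *)

Section Weights.
Variables (R : realType).

Definition acot (t : R) : R := pi / 2 - atan t.

Lemma acot_gt0 t : 0 < acot t.
Proof. by rewrite subr_gt0 atan_ltpi2. Qed.

Lemma atan_gt0 (t : R) : 0 < t -> 0 < atan t.
Proof. by move=> t0; rewrite -(atan0 R) lt_atan. Qed.

Lemma acot_lt t : 0 < t -> acot t < pi / 2.
Proof. by move=> t0; rewrite /acot ltrBlDr ltrDl atan_gt0. Qed.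

Lemma cos_acot t : cos (acot t) = t / Num.sqrt (1 + t ^+ 2).
Proof.
rewrite /acot cosB cos_pihalf sin_pihalf mul0r add0r mul1r -cos_atan.
have c0 : cos (atan t) != 0.
  by rewrite gt_eqF// cos_atan invr_gt0 sqrtr_gt0 ltr_pwDl// sqr_ge0.
have := atanK t; rewrite /tan => /(congr1 ( *%R^~ (cos (atan t)))).
by rewrite mulfVK.
Qed.

Lemma acot_near0 (P : set R) : (\forall t \near (pi / 2 : R)^'-, P t) ->
  exists2 e, 0 < e & forall t, 0 < t -> t < e -> P (acot t).
Proof.
rewrite near_withinE => /nbhs_ballP[dl /= dl0 hdl].
have /cvgrPdist_lt := @continuous_atan R 0.
rewrite atan0 => /(_ _ dl0) /nbhs_ballP[e /= e0 he].
exists e => // t t0 te; apply: hdl; last exact: acot_lt.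
have := he t; rewrite /ball /= sub0r normrN gtr0_norm// => /(_ te).
by rewrite sub0r normrN /acot opprB addrC subrK.
Qed.

Lemma acot_near_pinfty (P : set R) : (\forall t \near (0 : R)^'+, P t) ->
  exists2 M, 0 < M & forall t, M <= t -> P (acot t).
Proof.
rewrite near_withinE => /nbhs_ballP[dl /= dl0 hdl].
have := @cvgy_atan R.
move=> /cvgrPdist_lt /(_ _ dl0) [M [Mr hM]].
exists (Num.max 1 (M + 1)) => [|t]; first by rewrite lt_max ltr01.
rewrite ge_max => /andP[t1 tM]; apply: hdl; last exact: acot_gt0.
rewrite /ball /= sub0r normrN; apply: hM.
by apply: lt_le_trans tM; rewrite ltrDl.
Qed.

Variables (n : nat) (w : 'I_n -> R -> R).
Hypothesis wpos : forall i t, 0 < t -> t < pi / 2 -> 0 < w i t.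
Hypothesis wsmooth : forall i, smooth_on_itv 0 (pi / 2) (w i).
Hypothesis wlim : forall i, w i t @[t --> (pi / 2 : R)^'-] --> +oo.

(* [sin (acot t)] is the inverse of the square root. *)
Definition force i (t : R) : R := w i (acot t) / Num.sqrt (1 + t ^+ 2).

Let sqrt_gt0 (t : R) : 0 < Num.sqrt (1 + t ^+ 2).
Proof. by rewrite sqrtr_gt0 ltr_pwDl// sqr_ge0. Qed.

(** The left side is the derivative of an antiderivative of the force with respect to [ln t]; thus
    the limits in the hypothesis of the theorem become logarithmic growth rates. *)
Lemma forceE i t : t * force i t = w i (acot t) * cos (acot t).
Proof. by rewrite cos_acot /force; ring. Qed.

Lemma force_gt0 i t : 0 < t -> 0 < force i t.
Proof. by move=> t0; rewrite divr_gt0// wpos ?acot_gt0 ?acot_lt. Qed.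

Lemma force_cont i t : 0 < t -> {for t, continuous (force i)}.
Proof.
move=> t0; apply: cvgM.
  apply: (cvg_comp acot (w i) (G := nbhs (acot t))).
    by apply: cvgB; [exact: cvg_cst|exact: continuous_atan].
  have /= := @wsmooth i 0%N _ (acot_gt0 t) (acot_lt t0).
  by move=> /derivable1_diffP; exact: differentiable_continuous.
apply: cvgV; first by rewrite gt_eqF.
apply: (cvg_comp (fun t : R => 1 + t ^+ 2) Num.sqrt (G := nbhs (1 + t ^+ 2))).
  by apply: cvgD; [exact: cvg_cst|apply: cvgM; exact: cvg_id].
exact: sqrt_continuous.
Qed.

Lemma force_pinfty i M : exists2 e, 0 < e & forall t, 0 < t -> t < e -> M < force i t.
Proof.
(* The factor [2] absorbs the square root in the force, which is at most [2] for [t < 1]. *)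
have : \forall t \near (pi / 2 : R)^'-, 2 * Num.max M 0 < w i t.
  have /cvgryPgt := wlim i; exact.
move=> /acot_near0 [e e0 he]; exists (Num.min e 1) => [|t t0]; first by rewrite lt_min e0 ltr01.
rewrite lt_min => /andP[te t1]; apply: le_lt_trans (_ : Num.max M 0 < _).
  by rewrite le_max lexx.
rewrite /force ltr_pdivlMr//; apply: le_lt_trans (he _ t0 te).
rewrite mulrC ler_wpM2r ?le_max ?lexx ?orbT//.
rewrite -(@ler_pXn2r _ 2)// ?nnegrE ?ltW// sqr_sqrtr ?addr_ge0 ?sqr_ge0//.
by nra.
Qed.

Lemma force_near0 (I : pred 'I_n) (x : \bar R) (al : R) :
  (\sum_(i < n | I i) w i t * cos t)%:E @[t --> (pi / 2 : R)^'-] --> x ->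
  (x < al%:E)%E -> exists2 e, 0 < e &
    forall t, 0 < t -> t < e -> \sum_(i < n | I i) t * force i t <= al.
Proof.
move=> hx xal.
have : \forall y \near x, (y < al%:E)%E.
  by apply: open_nbhs_nbhs; split; [exact: open_ereal_lt_ereal|].
move=> /hx /acot_near0 [e e0 he]; exists e => // t t0 te.
have := he _ t0 te; rewrite /= lte_fin => /ltW; apply: le_trans.
by rewrite le_eqVlt; apply/orP; left; apply/eqP; apply: eq_bigr => i _; rewrite forceE.
Qed.

Lemma force_near_pinfty (I : pred 'I_n) (x : \bar R) (be be' : R) :
  (\sum_(i < n | I i) w i t)%:E @[t --> (0 : R)^'+] --> x ->
  (be'%:E < x)%E -> 0 < be -> be < be' -> exists2 M, 0 < M &
    forall t, M <= t -> be <= \sum_(i < n | I i) t * force i t.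
Proof.
move=> hx xal be0 bb'.
have : \forall y \near x, (be'%:E < y)%E.
  by apply: open_nbhs_nbhs; split; [exact: open_ereal_gt_ereal|].
move=> /hx /acot_near_pinfty [M M0 hM].
(* From there on [be * (1 + t) <= be' * t], and the square root is at most [1 + t]. The gap between
   [be] and [be'] pays for the factor [cos]. *)
exists (Num.max M (be / (be' - be))) => [|t]; first by rewrite lt_max M0.
rewrite ge_max => /andP[tM tb].
have t0 : 0 < t by exact: lt_le_trans tM.
have := hM _ tM; rewrite /= lte_fin => wb.
have -> : \sum_(i < n | I i) t * force i t =
    (\sum_(i < n | I i) w i (acot t)) * (t / Num.sqrt (1 + t ^+ 2)).
  by rewrite mulr_suml; apply: eq_bigr => i _; rewrite forceE cos_acot.
have st : Num.sqrt (1 + t ^+ 2) <= 1 + t.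
  rewrite -(@ler_pXn2r _ 2)// ?nnegrE ?ltW ?addr_gt0// sqr_sqrtr ?addr_ge0 ?sqr_ge0//.
  by nra.
rewrite mulrA ler_pdivlMr//.
have b0 : 0 < be' - be by rewrite subr_gt0.
move: tb; rewrite ler_pdivrMr// => tb.
apply: le_trans (_ : be * (1 + t) <= _); first by rewrite ler_wpM2l// ltW.
apply: le_trans (_ : be' * t <= _); first by lra.
by rewrite ler_wpM2r// ltW.
Qed.

(* [I] is meant to be the set of the caps through a boundary point of the
   [i]-th cap. *)
Lemma force_bound (I : pred 'I_n) (al e : R) i : 0 < e -> I i ->
  (forall t, 0 < t -> t < e -> \sum_(i < n | I i) t * force i t <= al) ->
  exists K, forall t, 0 < t -> t <= 1 -> t * force i t <= K.
Proof.
move=> e0 Ii he.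
pose e1 := Num.min (e / 2) 1.
have e10 : 0 < e1 by rewrite lt_min ltr01 divr_gt0.
have e11 : e1 <= 1 by rewrite ge_min lexx orbT.
have e1e : e1 < e.
  by apply: le_lt_trans (_ : e / 2 < e); [rewrite ge_min lexx|lra].
have cw : {within `[e1, 1], continuous (fun t => t * force i t)}.
  apply: continuous_in_subspaceT => t /set_mem; rewrite /= in_itv/= => /andP[t1 _].
  apply: cvgM; first exact: cvg_id.
  by apply: force_cont; exact: lt_le_trans t1.
have [c _ hc] := EVT_max e11 cw.
exists (Num.max al (c * force i c)) => t t0 t1; rewrite le_max.
have [te|te] := ltP t e1; last by rewrite hc ?orbT// in_itv/= te.
apply/orP; left; apply: le_trans (he t t0 (lt_trans te e1e)).
rewrite (bigD1 i)//= lerDl; apply: sumr_ge0 => j _.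
by rewrite mulr_ge0 ?ltW// force_gt0.
Qed.

End Weights.

Lemma exists_orthogonal (R : realType) d (c : 'rV[R]_d.+1) : (1 < d.+1)%N ->
  exists2 u, @sphere R d u & dot c u = 0.
Proof.
move=> d1; pose j0 : 'I_d.+1 := ord0; pose j1 : 'I_d.+1 := Ordinal d1.
pose E (j : 'I_d.+1) : 'rV[R]_d.+1 := delta_mx ord0 j.
have dE j x : dot x (E j) = x ord0 j.
  rewrite /dot (bigD1 j)//= big1 ?addr0; last first.
    by move=> k kj; rewrite mxE (negPf kj) andbF mulr0.
  by rewrite mxE !eqxx mulr1.
suff [u u0 cu] : exists2 u, u != 0 & dot c u = 0.
  exists (normalize u); first exact: normalize_sphere.
  by rewrite /normalize dotZr cu mulr0.
have [c0|c0] := eqVneq (c ord0 j0) 0.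
  exists (E j0); last by rewrite dE.
  by rewrite -dot_eq0 dE mxE !eqxx oner_eq0.
exists (c ord0 j0 *: E j1 - c ord0 j1 *: E j0); last first.
  by rewrite dotBr !dotZr !dE mulrC subrr.
apply/eqP => /rowP /(_ j1); rewrite !mxE /= mulr1 mulr0 subr0 => /eqP.
by rewrite (negPf c0).
Qed.

(** * Critical points of the truncated potential *)

Section Line.
Variables (R : realType) (d : nat).
Implicit Types (x y z v p a : 'rV[R]_d.+1).

Lemma descent_line (g Dg : 'rV[R]_d.+1 -> R) p v :
  (forall x (t : R), is_derive t 1 (fun t : R => g (x + t *: v)) (Dg (x + t *: v))) ->
  {for p, continuous Dg} -> Dg p < 0 ->
  exists2 r : R, 0 < r & forall x t, ball p r x -> 0 < t -> t < r -> g (x + t *: v) < g x.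
Proof.
move=> dg cD Dp.
have [e e0 he] : exists2 e : R, 0 < e & forall x, ball p e x -> Dg x < 0.
  have : \forall x \near p, Dg x < 0 by exact: (cvgr_lt (Dg p) cD).
  by move=> /nbhs_ballP[e /= e0 he]; exists e.
have v1 : 0 < 1 + `|v| by rewrite ltr_pwDl.
(* This radius [r] solves [r + r * |v| = e], so the whole segment stays where the derivative is
   negative. *)
exists (e / (1 + `|v|)) => [|x t]; first by rewrite divr_gt0.
rewrite ball_rVE => px t0 te.
have wg : {within `[0, t], continuous (fun t : R => g (x + t *: v))}.
  by apply: (@is_derive_within _ _ (fun t => Dg (x + t *: v))) => s _; exact: dg.
have [s] := @MVT R _ (fun t => Dg (x + t *: v)) 0 t t0 (fun s _ => dg x s) wg.
rewrite in_itv/= => /andP[s0 st]; rewrite scale0r addr0 subr0 => e1.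
rewrite -subr_lt0 e1 pmulr_llt0//; apply: he; rewrite ball_rVE.
rewrite opprD addrA; apply: le_lt_trans (ler_normB _ _) _.
rewrite normrZ gtr0_norm//.
have -> : e = e / (1 + `|v|) + e / (1 + `|v|) * `|v| by field; rewrite gt_eqF.
rewrite ltr_leD// ler_wpM2r// ltW//; exact: lt_trans te.
Qed.

Lemma fin_radius n (Q : 'I_n -> R -> Prop) :
  (forall i r r', 0 < r' -> r' <= r -> Q i r -> Q i r') ->
  (forall i, exists2 r, 0 < r & Q i r) -> exists2 r, 0 < r & forall i, Q i r.
Proof.
move=> mono h.
have /choice[f hf] : forall i, exists r, 0 < r /\ Q i r.
  by move=> i; have [r r0 Qr] := h i; exists r.
have r0 : 0 < \big[Num.min/1]_i f i.
  by elim/big_rec: _ => // i y _ y0; rewrite lt_min y0 (hf i).1.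
exists (\big[Num.min/1]_i f i) => // i; apply: mono (hf i).2 => //.
by rewrite (bigD1 i)//= ge_min lexx.
Qed.

Lemma height_continuous : continuous (@height R d).
Proof.
move=> z; apply: (cvg_comp (fun z => 1 + dot z z) Num.sqrt (G := nbhs (1 + dot z z))).
  by apply: (@continuousD R R 'rV[R]_d.+1 (cst 1) (fun z => dot z z)); [exact: cst_continuous|exact: dotxx_continuous].
exact: sqrt_continuous.
Qed.

Lemma lin_continuous a A : continuous (lin a A).
Proof.
move=> z; apply: (@continuousB R R 'rV[R]_d.+1 (fun z => A * height z) (dot a)).
  by apply: (@continuousM R 'rV[R]_d.+1 (cst A) (@height R d)); [exact: cst_continuous|exact: height_continuous].
have -> : dot a = (fun x => dot x a) by apply/funext => x; rewrite dotC.
exact: dot_continuous.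
Qed.

Definition dlin a (A : R) v z : R := A * dot z v / height z - dot a v.

Lemma dlin_continuous a A v : continuous (dlin a A v).
Proof.
move=> z; apply: (@continuousB R R 'rV[R]_d.+1 (fun z => A * dot z v / height z) (cst (dot a v))); last exact: cst_continuous.
apply: (@continuousM R 'rV[R]_d.+1 (fun z => A * dot z v) (fun z => (height z)^-1)).
  by apply: (@continuousM R 'rV[R]_d.+1 (cst A) (fun z => dot z v)); [exact: cst_continuous|exact: dot_continuous].
by apply: (@continuousV _ 'rV[R]_d.+1 (@height R d) z); [rewrite gt_eqF ?height_gt0|exact: height_continuous].
Qed.

Lemma height_derive x v (t : R) :
  is_derive t 1 (fun t : R => height (x + t *: v)) (dot (x + t *: v) v / height (x + t *: v)).
Proof.
pose q (t : R) := 1 + dot (x + t *: v) (x + t *: v).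
have dq : is_derive t 1 q (2 * dot (x + t *: v) v).
  have -> : q = cst (1 + dot x x) + ((fun t => (2 * dot x v) * t) + (fun t => dot v v * t) * (id : R -> R)).
    by apply/funext => s; rewrite /q !dotE (dotC v x) /= !fctE; ring.
  have h1 := is_deriveMid (2 * dot x v) t; have h2 := is_deriveMid (dot v v) t.
  have h3 := is_deriveD h1 (is_deriveM h2 (is_derive_id t 1)).
  apply: (is_derive_eq (is_deriveD (is_derive_cst (1 + dot x x) t 1) h3)).
  by rewrite dotDl dotZl add0r /GRing.scale /=; ring.
have q0 : 0 < q t by rewrite /q ltr_pwDl// dot_ge0.
apply: (is_derive_eq (is_derive1_comp (is_derive1_sqrt q0) dq)).
have := height_gt0 (x + t *: v); rewrite /height -/(q t) => h.
by field; rewrite gt_eqF.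
Qed.

Lemma lin_derive a A x v (t : R) :
  is_derive t 1 (fun t : R => lin a A (x + t *: v)) (dlin a A v (x + t *: v)).
Proof.
have h1 := height_derive x v t; have h2 := is_deriveMid (dot a v) t.
have -> : (fun t : R => lin a A (x + t *: v)) =
   A *: (fun t : R => height (x + t *: v)) - (cst (dot a x) + (fun t => dot a v * t)).
  by apply/funext => s; rewrite /lin !dotE fctE /= !fctE /= [s * _]mulrC.
by apply: is_derive_eq; rewrite add0r /dlin /GRing.scale /= mulrA.
Qed.

(** For [A > 0] this is negative wherever [lin a A z <= 0]: such a point gets deeper when it moves
    outwards. *)
Lemma dlin_radial a A z : dlin a A z z = lin a A z - A / height z.
Proof.
rewrite /dlin /lin.
have -> : dot z z = height z ^+ 2 - 1 by rewrite height_sq addrC addKr.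
by have := height_gt0 z => h; field; rewrite gt_eqF.
Qed.

Lemma bounded_height_compact (S : set 'rV[R]_d.+1) (M : R) :
  closed S -> (forall z, S z -> height z <= M) -> compact S.
Proof.
move=> Sc SM; apply: bounded_closed_compact => //.
exists M; split; first exact: num_real.
move=> y My z /SM zM; apply: ltW; apply: le_lt_trans My; apply: le_trans zM.
rewrite /height /Num.norm /= mx_normrE; apply/bigmax_leP; split; first exact: sqrtr_ge0.
move=> [i j] _ /=; rewrite (ord1 i); apply: le_trans (coord_le_norm z j) _.
by rewrite ler_sqrt ?lerDr// addr_ge0// dot_ge0.
Qed.

(** Along an ultrafilter bounded vectors converge, which avoids successive subsequences. *)
Lemma ultra_ball_limit (T : Type) (F : set_system T) (FU : UltraFilter F)
    (x : T -> 'rV[R]_d.+1) :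
  (\forall t \near F, dot (x t) (x t) <= 1) ->
  exists q : 'rV[R]_d.+1, x t @[t --> F] --> q.
Proof.
move=> FB.
pose B := [set x : 'rV[R]_d.+1 | dot x x <= 1].
have Bc : compact B.
  apply: (@bounded_height_compact _ (Num.sqrt 2)).
    rewrite (_ : B = (fun x => dot x x) @^-1` [set y | y <= 1])//.
    by apply: closed_comp; [move=> y _; exact: dotxx_continuous|exact: closed_le].
  by move=> y By; rewrite /height ler_sqrt//; rewrite /B /= in By; lra.
have xU : UltraFilter (x @ F).
  split; first exact: fmap_proper_filter.
  move=> G GP xG; apply/seteqP; split => // U GU.
  have [//|] := in_ultra_setVsetC (x @^-1` U) FU.
  move=> FnU; have : G (U `&` ~` U) by apply: filterI => //; apply: xG.
  by rewrite setICr => /filter_not_empty.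
by move: Bc; rewrite compact_ultra => /(_ _ xU FB) [q [_ /= qF]]; exists q.
Qed.

Lemma far_limit (T : Type) (F : set_system T) (FU : UltraFilter F) (z : T -> 'rV[R]_d.+1) :
  (forall M, \forall t \near F, M < height (z t)) ->
  exists2 q, @sphere R d q & (height (z t))^-1 *: z t @[t --> F] --> q.
Proof.
move=> hF.
pose x t := (height (z t))^-1 *: z t.
have xx t : dot (x t) (x t) = 1 - (height (z t))^-1 ^+ 2.
  rewrite /x !dotE; have -> : dot (z t) (z t) = height (z t) ^+ 2 - 1 by rewrite height_sq addrC addKr.
  by have := height_gt0 (z t) => h; field; rewrite gt_eqF.
have [q qF] : exists q : 'rV[R]_d.+1, x t @[t --> F] --> q.
  by apply: ultra_ball_limit; apply: filterE => t; rewrite xx gerBl sqr_ge0.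
exists q => //.
have h1 : dot (x t) (x t) @[t --> F] --> dot q q by apply: dot_cvg.
have h2 : dot (x t) (x t) @[t --> F] --> (1 : R).
  rewrite (_ : (fun t => dot (x t) (x t)) = (fun t => 1 - (height (z t))^-1 ^+ 2)); last first.
    by apply/funext => t; rewrite xx.
  rewrite -[X in _ --> X]subr0; apply: cvgB; first exact: cvg_cst.
  apply/cvgrPdist_lt => e e0.
  near=> t; rewrite sub0r normrN ger0_norm ?sqr_ge0//.
  have : Num.max 1 e^-1 < height (z t) by near: t; exact: hF.
  rewrite gt_max => /andP[t1 te].
  have t0 := height_gt0 (z t).
  apply: le_lt_trans (_ : (height (z t))^-1 < e).
    by rewrite expr2 ler_piMr ?invr_ge0 ?ltW// invf_lt1.
  by rewrite -[e]invrK ltf_pV2 ?posrE ?invr_gt0.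
exact: (cvg_unique _ h1 h2).
Unshelve. all: by end_near. Qed.

End Line.

Lemma is_derive_bigsum (R : realType) (I : Type) (r : seq I) (P : pred I)
    (F : I -> R -> R) (dF : I -> R) (t : R) :
  (forall i, P i -> is_derive t 1 (F i) (dF i)) ->
  is_derive t 1 (fun t => \sum_(i <- r | P i) F i t) (\sum_(i <- r | P i) dF i).
Proof.
move=> h; elim: r => [|i r IH].
  rewrite (_ : (fun t => _) = cst 0); last by apply/funext => s; rewrite big_nil.
  by rewrite big_nil; exact: is_derive_cst.
rewrite big_cons; case: ifPn => Pi; last first.
  rewrite (_ : (fun t => _) = (fun t => \sum_(j <- r | P j) F j t))//.
  by apply/funext => s; rewrite big_cons (negPf Pi).
rewrite (_ : (fun t => _) = F i + (fun t => \sum_(j <- r | P j) F j t)).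
  by apply: is_deriveD; exact: h.
by apply/funext => s; rewrite big_cons Pi.
Qed.

(** * Logarithmic growth of the antiderivatives *)

Section Growth.
Variables (R : realType) (n : nat) (phi h : 'I_n -> R -> R) (K : R).
Hypothesis phi_gt0 : forall i t, 0 < t -> 0 < phi i t.
Hypothesis h1 : forall i, h i 1 = 0.
Hypothesis dh : forall i (t : R), 0 < t -> is_derive t 1 (h i) (phi i t).

Lemma h_mono i x y : 0 < x -> x <= y -> h i x <= h i y.
Proof.
move=> x0 xy.
have := @incr_le _ (cst 0) (h i) (cst 0) (phi i) x y xy.
rewrite subrr subr_ge0; apply => t /andP[xt _].
  by apply: dh; exact: lt_le_trans xt.
by apply: ltW; apply: phi_gt0; exact: lt_le_trans xt.
Qed.

Lemma low_growth (I : pred 'I_n) (al e : R) : 0 < e ->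
  (forall t, 0 < t -> t < e -> \sum_(i < n | I i) t * phi i t <= al) ->
  exists C, forall t, 0 < t -> t <= 1 -> al * ln t - C <= \sum_(i < n | I i) h i t.
Proof.
move=> e0 he.
pose e1 := Num.min (e / 2) 1.
have e10 : 0 < e1 by rewrite lt_min ltr01 divr_gt0.
have e11 : e1 <= 1 by rewrite ge_min lexx orbT.
have e1e : e1 < e by apply: le_lt_trans (_ : e / 2 < e); [rewrite ge_min lexx|lra].
have al0 : 0 <= al.
  apply: le_trans (he _ e10 e1e); apply: sumr_ge0 => i _.
  by rewrite mulr_ge0 ?ltW// phi_gt0.
pose H t := \sum_(i < n | I i) h i t.
exists (`|H e1| + `|al * ln e1|) => t t0 t1.
have n1 := ler_norm (- H e1); have n2 := ler_norm (al * ln e1).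
rewrite normrN in n1.
have [te|te] := leP t e1; last first.
  have : H e1 <= H t by apply: ler_sum => i _; apply: h_mono => //; exact: ltW.
  have : al * ln t <= 0 by rewrite mulr_ge0_le0// ln_le0.
  have := normr_ge0 (al * ln e1); rewrite -/(H t); lra.
have := @incr_le _ H (fun t => al * ln t) (fun t => \sum_(i < n | I i) phi i t) (fun t => al * t^-1) t e1 te.
have H1 : forall x : R, t <= x <= e1 -> is_derive x 1 H (\sum_(i < n | I i) phi i x).
  move=> x /andP[tx _]; apply: is_derive_bigsum => i _; apply: dh.
  exact: lt_le_trans tx.
have H2 : forall x : R, t <= x <= e1 -> is_derive x 1 (fun t => al * ln t) (al * x^-1).
  move=> x /andP[tx _]; have x0 := lt_le_trans t0 tx.
  have := is_derive1_ln x0 => hl.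
  exact: (@is_deriveZ R R R (@ln R) al x 1 _ hl).
move=> /(_ H1 H2).
have H3 : forall x, t <= x <= e1 -> \sum_(i < n | I i) phi i x <= al * x^-1.
  move=> x /andP[tx xe]; have x0 := lt_le_trans t0 tx.
  rewrite ler_pdivlMr// mulr_suml; apply: le_trans (he x x0 (le_lt_trans xe e1e)).
  by apply: ler_sum => i _; rewrite mulrC.
move=> /(_ H3); rewrite -/(H t); lra.
Qed.

(** The constant is uniform in the truncation: where a force of the family is cut off, its product
    alone is [k >= be]; where none is, the original bound applies. *)
Lemma high_growth (J : pred 'I_n) (be M : R) : 0 < be -> 0 < M ->
  (forall t, M <= t -> be <= \sum_(i < n | J i) t * phi i t) ->
  exists C, forall k psi e s, be <= k ->
    (forall i, truncated (phi i) K (h i) k (psi i) (e i) (s i)) ->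
    forall t, 1 <= t -> be * ln t - C <= \sum_(i < n | J i) e i t.
Proof.
move=> be0 M0 hM.
pose M1 := Num.max M 1.
have M11 : 1 <= M1 by rewrite le_max lexx orbT.
have MM1 : M <= M1 by rewrite le_max lexx.
exists (be * ln M1) => k psi e s bek tr t t1.
pose E t := \sum_(i < n | J i) e i t.
have emono i x y : x <= y -> e i x <= e i y.
  move=> xy; have := @incr_le _ (cst 0) (e i) (cst 0) (psi i) x y xy.
  have de := tr_derive (tr i).
  rewrite subrr subr_ge0; apply => u _; exact: ltW (tr_gt0 (tr i) u).
have E0 x : 1 <= x -> 0 <= E x.
  by move=> x1; apply: sumr_ge0 => i _; rewrite -(tr_e1 (tr i)); exact: emono.
rewrite -/(E t).
have [tM|Mt] := leP t M1.
  have : be * ln t <= be * ln M1.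
    by rewrite ler_pM2l// ler_ln ?posrE//; exact: lt_le_trans ltr01 _.
  by have := E0 _ t1; lra.
have := @incr_le _ (fun t => be * ln t) E (fun t => be * t^-1) (fun t => \sum_(i < n | J i) psi i t) M1 t (ltW Mt).
have H1 : forall x : R, M1 <= x <= t -> is_derive x 1 (fun t => be * ln t) (be * x^-1).
  move=> x /andP[tx _]; have x0 := lt_le_trans ltr01 (le_trans M11 tx).
  have := is_derive1_ln x0 => hl.
  exact: (@is_deriveZ R R R (@ln R) be x 1 _ hl).
have H2 : forall x : R, M1 <= x <= t -> is_derive x 1 E (\sum_(i < n | J i) psi i x).
  by move=> x _; apply: is_derive_bigsum => i _; exact: tr_derive (tr i) x.
move=> /(_ H1 H2).
have H3 : forall x, M1 <= x <= t -> be * x^-1 <= \sum_(i < n | J i) psi i x.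
  move=> x /andP[Mx _]; have x1 := le_trans M11 Mx; have x0 := lt_le_trans ltr01 x1.
  rewrite ler_pdivrMr// mulr_suml.
  have [[i /andP[Ji hi]]|hn] := pselect (exists i, J i && (k < x * phi i x)).
    rewrite (bigD1 i)//= (tr_min (tr i) x1) (min_idPr _); last first.
      by rewrite ler_pdivrMr// mulrC ltW.
    rewrite divfK ?gt_eqF// (le_trans bek)// lerDl; apply: sumr_ge0 => j _.
    by rewrite mulr_ge0 ?ltW// (tr_gt0 (tr j)).
  apply: le_trans (hM x (le_trans MM1 Mx)) _; apply: ler_sum => i Ji.
  have m : Num.min (phi i x) (k / x) = phi i x.
    apply/min_idPl; rewrite ler_pdivlMr// mulrC leNgt.
    by apply/negP => hi; apply: hn; exists i; rewrite Ji.
  by rewrite (tr_min (tr i) x1) m mulrC.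
move=> /(_ H3); have := E0 _ M11; lra.
Qed.

End Growth.

Section Potential.
Variables (R : realType) (d n : nat).
Variables (a : 'I_n -> 'rV[R]_d.+1) (A : 'I_n -> R).
Hypothesis A_gt0 : forall i, 0 < A i.
Variables (psi e : 'I_n -> R -> R).
Hypothesis psi_cont : forall i, continuous (psi i).
Hypothesis psi_gt0 : forall i t, 0 < psi i t.
Hypothesis de : forall i (t : R), is_derive t 1 (e i) (psi i t).
Implicit Types (z v p x : 'rV[R]_d.+1).

Let L i z := lin (a i) (A i) z.

Definition pot z : R := \sum_(i < n) e i (L i z).
Definition dpot v z : R := \sum_(i < n) psi i (L i z) * dlin (a i) (A i) v z.
Definition mult z : R := \sum_(i < n) psi i (L i z) * L i z.

Lemma pot_derive x v (t : R) :
  is_derive t 1 (fun t : R => pot (x + t *: v)) (dpot v (x + t *: v)).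
Proof.
apply: is_derive_bigsum => i _.
exact: is_derive1_comp (de i _) (lin_derive (a i) (A i) x v t).
Qed.

Let comp_continuous (g : R -> R) i : continuous g -> continuous (fun z => g (L i z)).
Proof.
move=> gc z; apply: (cvg_comp (L i) g (G := nbhs (L i z))); last exact: gc.
exact: lin_continuous.
Qed.

Lemma pot_continuous : continuous pot.
Proof.
move=> z; apply: (@cvg_sumr R 'rV[R]_d.+1 _ (nbhs z) (nbhs_filter z) _ _ (fun i z => e i (L i z))) => i _.
apply: comp_continuous => t; exact: is_derive_continuous (de i t).
Qed.

Lemma dpot_continuous v : continuous (dpot v).
Proof.
move=> z; apply: (@cvg_sumr R 'rV[R]_d.+1 _ (nbhs z) (nbhs_filter z) _ _
  (fun i z => psi i (L i z) * dlin (a i) (A i) v z)) => i _.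
apply: (@continuousM R 'rV[R]_d.+1 (fun z => psi i (L i z)) (dlin (a i) (A i) v)).
  exact: comp_continuous.
exact: dlin_continuous.
Qed.

Lemma dpot_opp v z : dpot (- v) z = - dpot v z.
Proof.
rewrite /dpot -sumrN; apply: eq_bigr => i _.
by rewrite /dlin !dotNr; ring.
Qed.

(* At a critical point, the Minkowski vectors [(a i, A i)] weighted by [psi]
   sum up to [mult z] times the hyperboloid point [(z, height z)]. *)
Lemma critical_height z : (forall v, dpot v z = 0) ->
  \sum_(i < n) psi i (L i z) * A i = mult z * height z.
Proof.
move=> hz; have := hz z; rewrite /dpot.
have -> : \sum_(i < n) psi i (L i z) * dlin (a i) (A i) z z =
    mult z - (\sum_(i < n) psi i (L i z) * A i) / height z.
  rewrite /mult mulr_suml -sumrB; apply: eq_bigr => i _.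
  by rewrite dlin_radial -/(L i z); ring.
have := height_gt0 z => H0.
move/eqP; rewrite subr_eq0 => /eqP ->.
by rewrite divfK// gt_eqF.
Qed.

Lemma critical_dot z : (forall v, dpot v z = 0) -> forall v,
  \sum_(i < n) psi i (L i z) * dot (a i) v = mult z * dot z v.
Proof.
move=> hz v; have := hz v; rewrite /dpot.
have -> : \sum_(i < n) psi i (L i z) * dlin (a i) (A i) v z =
    (\sum_(i < n) psi i (L i z) * A i) * (dot z v / height z) - \sum_(i < n) psi i (L i z) * dot (a i) v.
  rewrite mulr_suml -sumrB; apply: eq_bigr => i _.
  by rewrite /dlin; ring.
rewrite (critical_height hz); have := height_gt0 z => H0.
move/eqP; rewrite subr_eq0 => /eqP <-.
by field; rewrite gt_eqF.
Qed.

Variables (k : R) (s : 'I_n -> R).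
Hypothesis k_gt0 : 0 < k.
Hypothesis s_gt0 : forall i, 0 < s i.
Hypothesis psi_le : forall i t, t * psi i t <= k.
Hypothesis psi_low : forall i t, t <= s i -> psi i t = k ^+ 2.

Let eps : R := n%:R / k.

(** This fixes [eps]: the [i]-th term is at most [- n * k] and the [n - 1] others are at most [k]
    each. *)
Lemma mult_lt0 z i : L i z <= - eps -> mult z < 0.
Proof.
move=> Li.
have n0 : (0 < n)%N by case: n i {Li} => [[]|].
have nR : 0 < n%:R :> R by rewrite ltr0n.
have e0 : 0 < eps by rewrite divr_gt0.
rewrite /mult (bigD1 i)//=.
have -> : psi i (L i z) = k ^+ 2.
  by apply: psi_low; apply: le_trans Li _; have := s_gt0 i; lra.
have h1 : k ^+ 2 * L i z <= - (n%:R * k).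
  apply: le_trans (_ : k ^+ 2 * - eps <= _); first by rewrite ler_pM2l// exprn_gt0.
  rewrite le_eqVlt; apply/orP; left; apply/eqP; rewrite /eps; field.
  by rewrite gt_eqF.
have h2 : \sum_(j < n | j != i) psi j (L j z) * L j z <= (n%:R - 1) * k.
  apply: le_trans (_ : \sum_(j < n | j != i) k <= _).
    by apply: ler_sum => j _; rewrite mulrC.
  rewrite sumr_const -[(n%:R - 1) * k]mulrC.
  have -> : #|(fun j : 'I_n => j != i)| = n.-1 by rewrite cardC1 card_ord.
  have -> : k * (n%:R - 1) = k *+ n.-1.
    by rewrite -[in LHS](prednK n0) -natr1 addrK mulr_natr.
  exact: lexx.
apply: le_lt_trans (lerD h1 h2) _.
have -> : - (n%:R * k) + (n%:R - 1) * k = - k by ring.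
by rewrite oppr_lt0.
Qed.

Lemma dpot_radial_lt0 z i : L i z <= - eps -> dpot z z < 0.
Proof.
move=> Li; have m0 := mult_lt0 Li.
have -> : dpot z z = mult z - (\sum_(i < n) psi i (L i z) * A i) / height z.
  rewrite /mult mulr_suml -sumrB; apply: eq_bigr => j _.
  by rewrite dlin_radial -/(L j z); ring.
have : 0 <= (\sum_(i < n) psi i (L i z) * A i) / height z.
  apply: divr_ge0; last exact: ltW (height_gt0 z).
  by apply: sumr_ge0 => j _; apply: mulr_ge0; exact: ltW.
lra.
Qed.

(** Together with [mult_lt0] this confines critical points to [L i z > - eps]. *)
Lemma mult_gt0 z : (0 < n)%N -> (forall v, dpot v z = 0) -> 0 < mult z.
Proof.
move=> n0 hz; have := height_gt0 z => H0.
rewrite -(pmulr_lgt0 _ H0) -critical_height//.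
rewrite (bigD1 (Ordinal n0))//= ltr_pwDl ?mulr_gt0//.
by apply: sumr_ge0 => j _; apply: mulr_ge0; exact: ltW.
Qed.

Section Pass.
Variables (P : pred 'I_n) (c0 : R) (S : set 'rV[R]_d.+1).
Hypothesis split : forall i j z, P i -> ~~ P j -> 0 <= L i z \/ 0 <= L j z.
Hypothesis proper : forall c, exists M, forall z, pot z <= c ->
  (forall i, - eps <= L i z) -> height z <= M.
Hypothesis S_conn : connected S.
Hypothesis S_sub : forall z, S z -> pot z <= c0.
Hypothesis SA : exists z i, [/\ S z, P i & L i z < - eps].
Hypothesis SB : exists z i, [/\ S z, ~~ P i & L i z < - eps].

Let N (Q : pred 'I_n) := [set z | exists2 i, Q i & L i z < - eps].

Let lin_open i c : open [set z | L i z < c].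
Proof. by have /continuousP := @lin_continuous R d (a i) (A i); move=> /(_ _ (@open_lt _ c)). Qed.

Let lin_open' i c : open [set z | c < L i z].
Proof. by have /continuousP := @lin_continuous R d (a i) (A i); move=> /(_ _ (@open_gt _ c)). Qed.

Let N_open Q : open (N Q).
Proof.
have -> : N Q = \bigcup_(i in [set i | Q i]) [set z | L i z < - eps].
  by apply/seteqP; split=> z; [case=> i Qi Li; exists i|case=> i Qi Li; exists i].
by apply: bigcup_open => i _; exact: lin_open.
Qed.

Let high_nbhs p (Q : pred 'I_n) : (forall i, Q i -> - eps < L i p) ->
  exists2 r : R, 0 < r & forall x, ball p r x -> forall i, Q i -> - eps < L i x.
Proof.
move=> hp.
have [|i|r r0 hr] := @fin_radius R n (fun i r => forall x, ball p r x -> Q i -> - eps < L i x).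
- move=> i r r' _ rr h x pr; apply: h.
  by move: pr; rewrite !ball_rVE => /lt_le_trans; exact.
- have [Qi|nQ] := boolP (Q i); last by exists 1.
  have [r r0 hr] := ball_nbhd (@lin_open' i (- eps)) (hp i Qi).
  by exists r => // x /hr.
by exists r => // x pr i; exact: hr.
Qed.

Let N_closure Q p : closure (N Q) p -> exists2 i, Q i & L i p <= - eps.
Proof.
move=> clp; apply: contrapT => h.
have [|r r0 hr] := @high_nbhs p Q.
  by move=> i Qi; rewrite ltNge; apply/negP => Li; apply: h; exists i.
have [x [[i Qi Li] px]] := clp _ (nbhsx_ballx p r r0).
by have := hr x px i Qi; rewrite ltNge (ltW Li).
Qed.

Lemma critical_point : exists2 z, pot z <= c0 & forall v, dpot v z = 0.
Proof.
apply: contrapT => nz.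
have n0 : (0 < n)%N by have [_ [i _]] := SA; case: n i => [[]|].
have e0 : 0 < eps by rewrite divr_gt0// ltr0n.
have nc p : pot p <= c0 -> exists v, dpot v p < 0.
  move=> pc; apply: contrapT => h; apply: nz; exists p => // v.
  apply/eqP; rewrite eq_le; apply/andP; split.
    rewrite leNgt; apply/negP => h'; apply: h; exists (- v).
    by rewrite dpot_opp oppr_lt0.
  by rewrite leNgt; apply/negP => h'; apply: h; exists v.
apply: (@mountain_pass R d pot (N P) (N [pred i | ~~ P i]) c0 _ _ _ _ _ _ S) => //.
- exact: pot_continuous.
- rewrite -subset0 => p [/N_closure[i Pi Li] /N_closure[j /= Pj Lj]].
  by have [] := split p Pi Pj; lra.
- move=> c; have [M hM] := proper c.
  apply: (@bounded_height_compact _ _ _ M).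
    rewrite setDE; apply: closedI.
      rewrite (_ : [set x | _] = pot @^-1` [set y | y <= c])//.
      by apply: closed_comp; [move=> x _; exact: pot_continuous|exact: closed_le].
    by apply: open_closedC; apply: openU; exact: N_open.
  move=> z [zc nN]; apply: hM => // i; rewrite leNgt; apply/negP => Li; apply: nN.
  by have [Pi|Pi] := boolP (P i); [left|right]; exists i.
- move=> p pc.
  (* If all [L i p] exceed [- eps], no nearby point lies in a region and any descent direction will
     do. Otherwise the radial direction lowers the potential and also every [L j] with
     [L j p <= - eps], which keeps both regions invariant. *)
  have [hp|/existsNP[i /negP]] := pselect (forall i, - eps < L i p).
    have [v hv] := nc p pc.
    have [r1 r10 h1] := descent_line (fun x t => pot_derive x v t) (@dpot_continuous v p) hv.
    have [r2 r20 h2] := @high_nbhs p xpredT (fun i _ => hp i).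
    exists v, (Num.min r1 r2); split; first by rewrite lt_min r10.
    move=> x t; rewrite ball_rVE lt_min => /andP[x1 x2] t0; rewrite lt_min => /andP[t1 t2].
    have nN Q : N Q x -> N Q (x + t *: v).
      case=> i _; have := h2 x; rewrite ball_rVE => /(_ x2 i isT).
      by move=> /lt_trans h /h; rewrite ltxx.
    by split; [apply: h1; rewrite ?ball_rVE|exact: nN|exact: nN].
  rewrite -leNgt => Li.
  have [r1 r10 h1] := descent_line (fun x t => pot_derive x p t) (@dpot_continuous p p) (dpot_radial_lt0 Li).
  have [|j|r2 r20 h2] := @fin_radius R n (fun j r => forall x (t : R), ball p r x -> 0 < t -> t < r ->
      L j x < - eps -> L j (x + t *: p) < - eps).
  + move=> j r r' _ rr h x t pr t0 tr; apply: h => //; last exact: lt_le_trans rr.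
    by move: pr; rewrite !ball_rVE => /lt_le_trans; exact.
  + have [Lj|Lj] := ltP (- eps) (L j p).
      have [r r0 hr] := ball_nbhd (@lin_open' j (- eps)) Lj.
      by exists r => // x t /hr /= h _ _ /(lt_trans h); rewrite ltxx.
    have Dj : dlin (a j) (A j) p p < 0.
      rewrite dlin_radial -/(L j p); have : 0 < A j / height p by rewrite divr_gt0 ?height_gt0.
      lra.
    have [r r0 hr] := descent_line (fun x t => lin_derive (a j) (A j) x p t) (@dlin_continuous R d (a j) (A j) p p) Dj.
    by exists r => // x t px t0 tr; apply: lt_trans; exact: hr.
  exists p, (Num.min r1 r2); split; first by rewrite lt_min r10.
  move=> x t; rewrite ball_rVE lt_min => /andP[x1 x2] t0; rewrite lt_min => /andP[t1 t2].
  have nN Q : N Q x -> N Q (x + t *: p).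
    by case=> j Qj Lj; exists j => //; apply: h2; rewrite ?ball_rVE.
  by split; [apply: h1; rewrite ?ball_rVE|exact: nN|exact: nN].
- by have [z [i [Sz Pi Li]]] := SA; exists z; split=> //; exists i.
- by have [z [i [Sz Pi Li]]] := SB; exists z; split=> //; exists i.
Qed.

End Pass.
End Potential.

(** * Degenerating sequences of critical points *)

Section Asymptotics.
Variables (R : realType) (d n : nat).
Variables (a : 'I_n -> 'rV[R]_d.+1) (A : 'I_n -> R).
Hypothesis A_gt0 : forall i, 0 < A i.
Hypothesis aa : forall i, dot (a i) (a i) = 1 + A i ^+ 2.
Variables (T : Type) (F : set_system T) (FU : UltraFilter F).
Variables (z : T -> 'rV[R]_d.+1) (psi : T -> 'I_n -> R -> R) (eps : T -> R) (K : R).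
Let L i t := lin (a i) (A i) (z t).
Hypothesis psi_gt0 : forall t i x, 0 < psi t i x.
Hypothesis crit : forall t v, dpot a A (psi t) v (z t) = 0.
Hypothesis psi_leK : forall t i x, x <= 1 -> x * psi t i x <= K.
Hypothesis L_ge : forall t i, - eps t <= L i t.
Hypothesis eps_small : forall e, 0 < e -> \forall t \near F, eps t < e.
Variable q : 'rV[R]_d.+1.
Hypothesis qs : @sphere R d q.
Let H t := height (z t).
Let x t := (H t)^-1 *: z t.
Hypothesis xq : x t @[t --> F] --> q.
Let J i := A i != dot (a i) q.
Hypothesis J_neq0 : exists i, J i.
Hypothesis A_ge : forall i, dot (a i) q <= A i.
Variable c : R.
Hypothesis c_gt0 : 0 < c.
Hypothesis L_large : \forall t \near F, forall i, J i -> c * H t <= L i t.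

(* In [x = (1 - nn) q + tau], the defect [nn] turns out to be of order
   [H ^ -2] and [tau] of smaller order than its square root. *)
Let lam t := mult a A (psi t) (z t).
Let W t i := psi t i (L i t) * L i t.
Let SJ t := \sum_(i < n | J i) W t i.
Let SI t := \sum_(i < n | ~~ J i) W t i.
Let nn t := 1 - dot (x t) q.
Let tau t := x t - dot (x t) q *: q.
Let tt t := dot (tau t) (tau t).
Let om t := H t ^+ 2 * nn t.

Let H0 t : 0 < H t. Proof. exact: height_gt0. Qed.

Let lamE t : lam t = SI t + SJ t.
Proof. by rewrite /lam /mult (bigID J)/= addrC. Qed.

Let n_gt0 : (0 < n)%N.
Proof. by have [i _] := J_neq0; case: n i => [[]|]. Qed.

Let lam0 t : 0 < lam t.
Proof. exact: mult_gt0. Qed.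

Let zE t : z t = H t *: x t.
Proof. by rewrite /x scalerA mulfV ?scale1r// gt_eqF. Qed.

Let LE i t : L i t = H t * (A i - dot (a i) (x t)).
Proof. by rewrite /L /lin -/(H t) {1}zE dotZr; ring. Qed.

(** The critical equation paired with the Minkowski vector [(v, s)]. It is used for the light vector
    [(q, 1)] and for the tangential direction [(u, 0)]. *)
Let test t v s : \sum_(i < n) psi t i (L i t) * (A i * s - dot (a i) v) = lam t * H t * (s - dot (x t) v).
Proof.
have h1 := critical_height (crit t); have h2 := critical_dot (crit t) v.
have -> : \sum_(i < n) psi t i (L i t) * (A i * s - dot (a i) v) =
   s * (\sum_(i < n) psi t i (L i t) * A i) - \sum_(i < n) psi t i (L i t) * dot (a i) v.
  by rewrite mulr_sumr -sumrB; apply: eq_bigr => i _; ring.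
rewrite h1 h2 -/(lam t) -/(H t) {1}zE dotZl; ring.
Qed.

Let xqc : dot (x t) q @[t --> F] --> (1 : R).
Proof. by rewrite -[X in _ --> X]qs; apply: dot_cvg => //; exact: cvg_cst. Qed.

Let nn_small e : 0 < e -> \forall t \near F, nn t < e.
Proof.
move=> e0; have h : \forall t \near F, 1 - e < dot (x t) q.
  by apply: (cvgr_gt 1 xqc); rewrite ltrBlDr ltrDl.
by apply: filterS h => t; rewrite /nn; lra.
Qed.

Let tau_q t : dot (tau t) q = 0.
Proof. by rewrite /tau dotBl dotZl qs mulr1 subrr. Qed.

Let x_split t : x t = (1 - nn t) *: q + tau t.
Proof. by rewrite /tau /nn opprB addrC !addrA [1 + _]addrC addrK subrK. Qed.

(** The hyperboloid equation in terms of [nn] and [tau]. It shows that [om] is close to [1 / 2] as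
    soon as [nn] is small and [tt] is small against [nn]. *)
Let norm_id t : 1 = 2 * om t - om t * nn t - H t ^+ 2 * tt t.
Proof.
have e1 : dot (x t) (x t) = (1 - nn t) ^+ 2 + tt t.
  have key (b : R) (y : 'rV[R]_d.+1) : dot y q = 0 ->
      dot (b *: q + y) (b *: q + y) = b ^+ 2 + dot y y.
    by move=> yq; rewrite !dotE (dotC q y) yq qs; ring.
  by rewrite {1 2}x_split key// tau_q.
have e2 : H t ^+ 2 * dot (x t) (x t) = H t ^+ 2 - 1.
  have : dot (z t) (z t) = H t ^+ 2 - 1 by rewrite /H height_sq addrC addKr.
  by rewrite {1 2}zE dotZl dotZr mulrA -expr2.
by rewrite /om; move: e2; rewrite e1; nra.
Qed.

Let tt_ge0 t : 0 <= tt t. Proof. exact: dot_ge0. Qed.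

Let nn_gt0 t : 0 < nn t.
Proof.
have h2 : 0 < H t ^+ 2 by rewrite exprn_gt0.
have h : 1 + H t ^+ 2 * tt t + H t ^+ 2 * nn t ^+ 2 = 2 * H t ^+ 2 * nn t.
  by rewrite {1}(norm_id t) /om; ring.
have h3 : 0 <= H t ^+ 2 * tt t by rewrite mulr_ge0 ?sqr_ge0.
have h4 : 0 <= H t ^+ 2 * nn t ^+ 2 by rewrite mulr_ge0 ?sqr_ge0.
have : 0 < 2 * H t ^+ 2 * nn t by lra.
by rewrite pmulr_rgt0// mulr_gt0.
Qed.

Let om_ge t : 1 / 2 <= om t.
Proof.
have h2 : 0 < H t ^+ 2 by rewrite exprn_gt0.
have := norm_id t.
have : 0 <= om t * nn t by rewrite /om -mulrA -expr2 mulr_ge0 ?sqr_ge0.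
have : 0 <= H t ^+ 2 * tt t by rewrite mulr_ge0 ?sqr_ge0.
lra.
Qed.

Let near_J : \forall t \near F, forall i, J i -> 0 < L i t.
Proof.
apply: filterS L_large => t h i /h; apply: lt_le_trans; exact: mulr_gt0.
Qed.

Let near_SJ : \forall t \near F, 0 < SJ t.
Proof.
apply: filterS near_J => t h; have [i Ji] := J_neq0.
rewrite /SJ (bigD1 i)//= ltr_pwDl//; first by rewrite mulr_gt0// h.
by apply: sumr_ge0 => j /andP[Jj _]; rewrite mulr_ge0 ?ltW// h.
Qed.

(** Pairing with [(q, 1)] eliminates the caps through [q]; for the others [H * (A - a . q)] is
    asymptotic to [L]. The tenths are mere slack. *)
Let near_ratio : \forall t \near F, 9 / 10 * SJ t <= lam t * om t <= 11 / 10 * SJ t.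
Proof.
have hr : \forall t \near F, forall i, J i ->
    9 / 10 * L i t <= H t * (A i - dot (a i) q) <= 11 / 10 * L i t.
  apply: filter_forall => i; have [Ji|nJ] := boolP (J i); last by apply: filterE.
  have l0 : 0 < A i - dot (a i) q by rewrite subr_gt0 lt_neqAle A_ge eq_sym andbT.
  pose l := A i - dot (a i) q.
  have hl : A i - dot (a i) (x t) @[t --> F] --> l.
    apply: cvgB; first exact: cvg_cst.
    by apply: dot_cvg => //; exact: cvg_cst.
  have h1 : \forall t \near F, A i - dot (a i) (x t) < 10 / 9 * l.
    by apply: (cvgr_lt l hl); rewrite -/l in l0; lra.
  have h2 : \forall t \near F, 10 / 11 * l < A i - dot (a i) (x t).
    by apply: (cvgr_gt l hl); rewrite -/l in l0; lra.
  near=> t => _; rewrite LE -/l.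
  have t1 : A i - dot (a i) (x t) < 10 / 9 * l by near: t.
  have t2 : 10 / 11 * l < A i - dot (a i) (x t) by near: t.
  have HH := H0 t.
  rewrite !mulrA [_ * H t]mulrC [11 / 10 * _]mulrC -!mulrA !ler_pM2l//.
  by apply/andP; split; lra.
near=> t.
have key : SJ t * 1 = SJ t by rewrite mulr1.
have e1 : lam t * om t = \sum_(i < n | J i) psi t i (L i t) * (H t * (A i - dot (a i) q)).
  have := test t q 1; rewrite -/(nn t) (bigID J)/= [X in _ + X]big1 ?addr0; last first.
    by move=> i; rewrite negbK => /eqP ->; rewrite mulr1 subrr mulr0.
  move=> /(congr1 ( *%R (H t))) e.
  have -> : lam t * om t = H t * (lam t * H t * nn t) by rewrite /om; ring.
  rewrite -e mulr_sumr; apply: eq_bigr => i _; rewrite mulr1; ring.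
have h : forall i, J i -> 9 / 10 * L i t <= H t * (A i - dot (a i) q) <= 11 / 10 * L i t by near: t.
rewrite e1 /SJ !mulr_sumr; apply/andP; split; apply: ler_sum => i Ji;
  have /andP[u1 u2] := h i Ji.
  by rewrite /W [leLHS]mulrCA ler_pM2l.
by rewrite /W [leRHS]mulrCA ler_pM2l.
Unshelve. all: by end_near. Qed.

Let a_tau i t : ~~ J i -> dot (a i) (tau t) = nn t * A i - L i t / H t.
Proof.
rewrite negbK => /eqP Ai; rewrite LE {1}x_split (dotDr ((1 - nn t) *: q) (tau t)) (dotZr (1 - nn t) q) -Ai.
by have := H0 t => h; field; rewrite gt_eqF.
Qed.

Let tt_small e : 0 < e -> \forall t \near F, tt t < e.
Proof.
move=> e0.
have : tau t @[t --> F] --> q - 1 *: q.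
  by apply: cvgB => //; apply: cvgZr_tmp; exact: xqc.
rewrite scale1r subrr => h.
have : tt t @[t --> F] --> dot (0 : 'rV[R]_d.+1) 0 by apply: dot_cvg.
by rewrite dot0l => /(cvgr_lt 0); apply.
Qed.

(* A limit direction [u] of the tangential part would move away from all the
   caps through [q], so that the critical equation fails in the direction [u]. *)
Let radial_approach c1 : 0 < c1 -> \forall t \near F, tt t < c1 * nn t.
Proof.
move=> c10; have [//|Fn] := in_ultra_setVsetC [set t | tt t < c1 * nn t] FU.
exfalso.
have hc : \forall t \near F, c1 * nn t <= tt t.
  by apply: filterS Fn => t /= /negP; rewrite -leNgt.
have tt0 : \forall t \near F, 0 < tt t.
  by apply: filterS hc => t; apply: lt_le_trans; rewrite mulr_gt0.
pose r t := Num.sqrt (tt t).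
pose th t := (r t)^-1 *: tau t.
have r2 t : r t ^+ 2 = tt t by rewrite sqr_sqrtr.
have r0 : \forall t \near F, 0 < r t by apply: filterS tt0 => t; rewrite sqrtr_gt0.
have thn : \forall t \near F, dot (th t) (th t) = 1.
  apply: filterS r0 => t rt.
  rewrite /th (dotZl (r t)^-1) (dotZr (r t)^-1) -/(tt t) -r2.
  by field; rewrite gt_eqF.
have [|u uF] := @ultra_ball_limit R d T F FU th.
  by apply: filterS thn => t ->.
have uu : dot u u = 1.
  have h1 : dot (th t) (th t) @[t --> F] --> dot u u by apply: dot_cvg.
  apply: (cvg_unique _ h1) => //.
  by apply: cvg_near_cst.
have rsmall e : 0 < e -> \forall t \near F, r t < e.
  move=> e0; have : \forall t \near F, tt t < e ^+ 2 by apply: tt_small; rewrite exprn_gt0.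
  apply: filterS => t; rewrite -r2 ltr_pXn2r ?nnegrE ?sqrtr_ge0//; exact: ltW.
have th_q t : dot (th t) q = 0 by rewrite /th (dotZl (r t)^-1) tau_q mulr0.
have uq : dot u q = 0.
  have h1 : dot (th t) q @[t --> F] --> dot u q by apply: dot_cvg => //; exact: cvg_cst.
  apply: (cvg_unique _ h1) => //.
  by apply: cvg_near_cst; apply: filterE.
pose kp := Num.sqrt (c1 / 2).
have kp0 : 0 < kp by rewrite sqrtr_gt0 divr_gt0.
have nnr : \forall t \near F, nn t <= r t ^+ 2 / c1.
  by apply: filterS hc => t; rewrite r2 ler_pdivlMr// mulrC.
have rH : \forall t \near F, kp <= r t * H t.
  apply: filterS nnr => t h.
  rewrite -(@ler_pXn2r _ 2)// ?nnegrE ?mulr_ge0 ?sqrtr_ge0 ?(ltW (H0 t))//.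
  have -> : kp ^+ 2 = c1 / 2 by rewrite sqr_sqrtr// divr_ge0// ltW.
  rewrite exprMn.
  have := om_ge t; rewrite /om => h2.
  have h3 : H t ^+ 2 * nn t <= H t ^+ 2 * (r t ^+ 2 / c1) by rewrite ler_wpM2l ?sqr_ge0.
  have h4 : H t ^+ 2 * (r t ^+ 2 / c1) = r t ^+ 2 * H t ^+ 2 / c1 by ring.
  have : 1 / 2 <= r t ^+ 2 * H t ^+ 2 / c1 by rewrite -h4; exact: le_trans h2 h3.
  by rewrite ler_pdivlMr// [1 / 2 * c1]mulrC mulrA mulr1.
(* By [a_tau] the product of [a i] with [th t] is at most [nn * A i / r + eps / (r * H)]; both terms
   tend to [0] by [nnr] and [rH]. *)
have uI i : ~~ J i -> dot (a i) u <= 0.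
  move=> Ji; rewrite leNgt; apply/negP => eta0.
  set eta := dot (a i) u in eta0.
  have h1 : dot (a i) (th t) @[t --> F] --> eta by apply: dot_cvg => //; exact: cvg_cst.
  have h2 : \forall t \near F, eta / 2 < dot (a i) (th t).
    by apply: (cvgr_gt eta h1); lra.
  have h3 : \forall t \near F, r t < eta * c1 / (4 * A i).
    by apply: rsmall; rewrite divr_gt0 ?mulr_gt0.
  have h4 : \forall t \near F, eps t < kp * (eta / 4).
    by apply: eps_small; rewrite !mulr_gt0 ?divr_gt0.
  suff : \forall t \near F, False by move/filter_ex => [].
  near=> t.
  have g2 : eta / 2 < dot (a i) (th t) by near: t.
  have g3 : r t < eta * c1 / (4 * A i) by near: t.
  have g4 : eps t < kp * (eta / 4) by near: t.
  have g5 : kp <= r t * H t by near: t.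
  have g6 : nn t <= r t ^+ 2 / c1 by near: t.
  have g7 : 0 < r t by near: t.
  have HH := H0 t; have AA := A_gt0 i; have LL := L_ge t i.
  move: g2; rewrite /th (dotZr (r t)^-1) (a_tau _ Ji) -ltr_pdivrMl ?invr_gt0// invrK => g2.
  have k1 : nn t * A i <= r t * (eta / 4).
    apply: le_trans (_ : r t ^+ 2 / c1 * A i <= _); first by rewrite ler_pM2r.
    have -> : r t ^+ 2 / c1 * A i = r t * (r t * (A i / c1)) by ring.
    rewrite ler_pM2l// -ler_pdivlMr ?divr_gt0//; apply: ltW; apply: lt_le_trans g3 _.
    by rewrite le_eqVlt; apply/orP; left; apply/eqP; field; rewrite !gt_eqF.
  have k2 : - L i t / H t < r t * (eta / 4).
    rewrite ltr_pdivrMr//; apply: le_lt_trans (_ : eps t < _); first by lra.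
    apply: lt_le_trans g4 _; rewrite mulrAC; rewrite ler_pM2r//; lra.
  by move: k2; rewrite mulNr; lra.
pose Ca := \sum_(i < n) `|dot (a i) u|.
have Ca0 : 0 <= Ca by apply: sumr_ge0.
have h1 : dot (th t) u @[t --> F] --> (1 : R).
  by rewrite -[X in _ --> X]uu; apply: dot_cvg => //; exact: cvg_cst.
have h2 : \forall t \near F, 1 / 2 < dot (th t) u.
  by apply: (cvgr_gt 1 h1); lra.
(* Pairing with [(u, 0)] will give [c / 2 <= 10 / 9 * Ca * r t / c1], which this bound refutes. *)
have h3 : \forall t \near F, r t < c * c1 / (4 * (Ca + 1)).
  by apply: rsmall; rewrite divr_gt0 ?mulr_gt0// ltr_wpDl.
suff : \forall t \near F, False by move/filter_ex => [].
near=> t.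
have g2 : 1 / 2 < dot (th t) u by near: t.
have g3 : r t < c * c1 / (4 * (Ca + 1)) by near: t.
have g4 : forall i, J i -> c * H t <= L i t by near: t.
have g5 : 9 / 10 * SJ t <= lam t * om t <= 11 / 10 * SJ t by near: t.
have g6 : nn t <= r t ^+ 2 / c1 by near: t.
have g7 : 0 < r t by near: t.
have HH := H0 t; have ll := lam0 t.
have xu : r t / 2 <= dot (x t) u.
  rewrite x_split (dotDl ((1 - nn t) *: q) (tau t)) (dotZl (1 - nn t)) (dotC q) uq mulr0 add0r.
  have -> : tau t = r t *: th t by rewrite /th scalerA mulfV ?scale1r// gt_eqF.
  by rewrite dotZl ler_pM2l//; lra.
have e1 : lam t * H t * dot (x t) u = \sum_(i < n) psi t i (L i t) * dot (a i) u.
  have := test t u 0; rewrite sub0r mulrN => /eqP; rewrite eq_sym eqr_oppLR => /eqP ->.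
  by rewrite -sumrN; apply: eq_bigr => i _; ring.
have e2 : \sum_(i < n) psi t i (L i t) * dot (a i) u <= \sum_(i < n | J i) psi t i (L i t) * Ca.
  rewrite (bigID J)/= -[leRHS]addr0 lerD//.
    apply: ler_sum => i _; rewrite ler_pM2l//; apply: le_trans (ler_norm _) _.
    by rewrite /Ca (bigD1 i)//= lerDl sumr_ge0.
  by apply: sumr_le0 => i /uI h; rewrite mulr_ge0_le0// ltW.
have e3 : (\sum_(i < n | J i) psi t i (L i t) * Ca) * (c * H t) <= Ca * SJ t.
  rewrite mulr_suml /SJ mulr_sumr; apply: ler_sum => i Ji.
  rewrite /W mulrAC mulrC ler_wpM2l// ler_pM2l//; exact: g4.
have cH : 0 < c * H t by rewrite mulr_gt0.
have e4 : lam t * H t * (r t / 2) * (c * H t) <= Ca * SJ t.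
  apply: le_trans e3; rewrite ler_pM2r//; apply: le_trans e2; rewrite -e1.
  by rewrite ler_pM2l// mulr_gt0.
have e5 : Ca * SJ t <= Ca * (10 / 9 * (lam t * (H t ^+ 2 * (r t ^+ 2 / c1)))).
  rewrite ler_wpM2l//; have : lam t * om t <= lam t * (H t ^+ 2 * (r t ^+ 2 / c1)).
    by rewrite ler_pM2l// /om ler_pM2l// exprn_gt0.
  by move: g5 => /andP[u1 _]; lra.
have P0 : 0 < lam t * H t ^+ 2 * r t by rewrite !mulr_gt0// exprn_gt0.
have e6 : lam t * H t ^+ 2 * r t * (c / 2) <= lam t * H t ^+ 2 * r t * (10 / 9 * Ca * r t / c1).
  have -> : lam t * H t ^+ 2 * r t * (c / 2) = lam t * H t * (r t / 2) * (c * H t) by ring.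
  apply: le_trans e4 _; apply: le_trans e5 _.
  rewrite le_eqVlt; apply/orP; left; apply/eqP; ring.
rewrite ler_pM2l// in e6.
move: g3; rewrite ltr_pdivlMr ?mulr_gt0 ?ltr_wpDl// => g3.
move: e6; rewrite ler_pdivlMr// => e6.
have : 0 <= r t * Ca by apply: mulr_ge0 => //; exact: ltW.
nra.
Unshelve. all: by end_near. Qed.

(** As [om] is nearly [1 / 2], the multiplier is nearly [2 * SJ], so the two groups of caps have
    nearly equal sums. The group through [q] has [L <= 1] and hence a sum of at most [n * K], which
    then bounds the rest. *)
Lemma far_estimate : \forall t \near F,
  [/\ mult a A (psi t) (z t) <= 5 * n%:R * K,
      forall i, A i != dot (a i) q -> 0 < L i t /\ psi t i (L i t) * L i t <= 2 * n%:R * K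
    & forall i, A i = dot (a i) q -> L i t <= 1 /\ - (n%:R * K) <= psi t i (L i t) * L i t].
Proof.
have hI : \forall t \near F, forall i, ~~ J i -> L i t <= 1.
  apply: filter_forall => i; have [Ji|nJ] := boolP (J i); first by apply: filterE.
  (* Chosen so that the two parts of [L i t], coming from [nn] and from [tau], are at most [1 / 2]
     each. *)
  pose c1 := (4 * (1 + A i ^+ 2))^-1.
  have A1 : 0 < 1 + A i ^+ 2 by rewrite ltr_pwDl// sqr_ge0.
  have c10 : 0 < c1 by rewrite invr_gt0 mulr_gt0.
  have h1 := nn_small c10; have h2 := radial_approach c10.
  have h3 : \forall t \near F, tt t < 1 / 10 * nn t by apply: radial_approach; lra.
  have h4 : \forall t \near F, nn t < 1 / 10 by apply: nn_small; lra.
  near=> t => _.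
  have g1 : nn t < c1 by near: t.
  have g2 : tt t < c1 * nn t by near: t.
  have g3 : tt t < 1 / 10 * nn t by near: t.
  have g4 : nn t < 1 / 10 by near: t.
  have HH := H0 t; have n0 := nn_gt0 t; have o1 := om_ge t.
  have H2 : 0 < H t ^+ 2 by rewrite exprn_gt0.
  have oE : om t = H t ^+ 2 * nn t by [].
  have Htt b : tt t < b * nn t -> H t ^+ 2 * tt t <= b * om t.
    by move=> hb; rewrite oE mulrCA ler_pM2l// ltW.
  (* By [norm_id], [1 >= (2 - 1 / 10 - 1 / 10) * om t]. *)
  have o2 : om t <= 5 / 9.
    have := Htt _ g3; have := norm_id t.
    have : om t * nn t <= om t * (1 / 10) by rewrite ler_wpM2l// ?ltW//; lra.
    lra.
  have ca : c1 * (1 + A i ^+ 2) = 1 / 4 by rewrite /c1; field; rewrite gt_eqF.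
  have Le : L i t = H t * nn t * A i - H t * dot (a i) (tau t).
    by rewrite (a_tau _ nJ); field; rewrite gt_eqF.
  pose y1 := H t * nn t * A i; pose y2 := H t * dot (a i) (tau t).
  have q1 : y1 ^+ 2 <= 1 / 4.
    have -> : y1 ^+ 2 = om t * nn t * A i ^+ 2 by rewrite /y1 /om; ring.
    apply: le_trans (_ : 1 * c1 * (1 + A i ^+ 2) <= _); last by rewrite mul1r ca.
    have on : om t * nn t <= 1 * c1.
      by apply: ler_pM; [lra|exact: ltW|lra|exact: ltW].
    apply: ler_pM => //; [|exact: sqr_ge0|lra].
    by apply: mulr_ge0; [lra|exact: ltW].
  have q2 : y2 ^+ 2 <= 1 / 4.
    apply: le_trans (_ : H t ^+ 2 * ((1 + A i ^+ 2) * tt t) <= _).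
      by rewrite /y2 exprMn ler_pM2l// -(aa i); exact: dot_CS.
    apply: le_trans (_ : (1 + A i ^+ 2) * (c1 * om t) <= _).
      by rewrite mulrCA ler_pM2l//; exact: Htt.
    have -> : (1 + A i ^+ 2) * (c1 * om t) = 1 / 4 * om t by rewrite -ca; ring.
    lra.
  have p1 : y1 <= 1 / 2 by rewrite leNgt; apply/negP => h; nra.
  have p2 : - y2 <= 1 / 2 by rewrite leNgt; apply/negP => h; nra.
  by rewrite Le -/y1 -/y2; lra.
have h3 : \forall t \near F, tt t < 1 / 10 * nn t by apply: radial_approach; lra.
have h4 : \forall t \near F, nn t < 1 / 10 by apply: nn_small; lra.
have K0 (t : T) : 0 < K.
  have [i _] := J_neq0; have := @psi_leK t i 1 (lexx 1).
  by rewrite mul1r; apply: lt_le_trans; exact: psi_gt0.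
near=> t.
have g1 : forall i, ~~ J i -> L i t <= 1 by near: t.
have g3 : tt t < 1 / 10 * nn t by near: t.
have g4 : nn t < 1 / 10 by near: t.
have g5 : forall i, J i -> 0 < L i t by near: t.
have g6 : 0 < SJ t by near: t.
have /andP[r1 r2] : 9 / 10 * SJ t <= lam t * om t <= 11 / 10 * SJ t by near: t.
have HH := H0 t; have n0 := nn_gt0 t; have o1 := om_ge t; have ll := lam0 t.
have Kt := K0 t; clear K0.
have H2 : 0 < H t ^+ 2 by rewrite exprn_gt0.
have oE : om t = H t ^+ 2 * nn t by [].
have o2 : om t <= 5 / 9.
  have : H t ^+ 2 * tt t <= 1 / 10 * om t by rewrite oE mulrCA ler_pM2l// ltW.
  have := norm_id t.
  have : om t * nn t <= om t * (1 / 10) by rewrite ler_wpM2l// ?ltW//; lra.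
  lra.
have l1 : lam t * (1 / 2) <= 11 / 10 * SJ t by apply: le_trans r2; rewrite ler_pM2l.
have l2 : 9 / 10 * SJ t <= lam t * (5 / 9) by apply: le_trans r1 _; rewrite ler_pM2l.
have WK i : ~~ J i -> W t i <= K by move=> /g1 h; rewrite /W mulrC; exact: psi_leK.
have sumK (Q : pred 'I_n) : \sum_(i < n | Q i) K <= n%:R * K.
  rewrite mulr_natl -[X in _ *+ X](card_ord n) -sumr_const big_mkcond /=.
  by apply: ler_sum => i _; case: ifP => // _; exact: ltW.
have SIK : SI t <= n%:R * K.
  by apply: le_trans (sumK (fun i => ~~ J i)); apply: ler_sum => i /WK.
have lE := lamE t.
have SI0 : 0 <= SI t by lra.
have SJK : SJ t <= 2 * n%:R * K by lra.
split.
- by rewrite -/(lam t); lra.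
- move=> i Ji; split; first exact: g5.
  apply: le_trans SJK; rewrite /SJ (bigD1 i)//= lerDl; apply: sumr_ge0 => j /andP[Jj _].
  by rewrite /W ltW// mulr_gt0// g5.
- move=> i /eqP Ai; have Ji : ~~ J i by rewrite negbK.
  split; first exact: g1.
  move: SI0; rewrite /SI (bigD1 i)//= => SI0.
  have : \sum_(j < n | ~~ J j && (j != i)) W t j <= n%:R * K.
    apply: le_trans (sumK (fun j => ~~ J j && (j != i))).
    by apply: ler_sum => j /andP[/WK].
  by move: SI0; rewrite /W; lra.
Unshelve. all: by end_near. Qed.

End Asymptotics.

(** The quotient of [lin] by the height converges to [A i - dot (a i) q]. A negative limit would
    push [lin] below [-1], and a positive one makes it grow linearly in the height. *)
Lemma far_caps (R : realType) (d n : nat) (a : 'I_n -> 'rV[R]_d.+1) (A : 'I_n -> R)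
    (T : Type) (F : set_system T) (FU : UltraFilter F) (z : T -> 'rV[R]_d.+1) :
  (forall M, \forall t \near F, M < height (z t)) ->
  (\forall t \near F, forall i, -1 <= lin (a i) (A i) (z t)) ->
  exists q c, [/\ @sphere R d q, (height (z t))^-1 *: z t @[t --> F] --> q,
    forall i, dot (a i) q <= A i, 0 < c
  & \forall t \near F, forall i, A i != dot (a i) q ->
      c * height (z t) <= lin (a i) (A i) (z t)].
Proof.
move=> hH hL; have [q qs xq] := far_limit FU hH.
pose l i t := A i - dot (a i) ((height (z t))^-1 *: z t).
have LE i t : lin (a i) (A i) (z t) = height (z t) * l i t.
  have h := height_gt0 (z t).
  by rewrite /lin /l dotZr; field; rewrite gt_eqF.
have lq i : l i t @[t --> F] --> A i - dot (a i) q.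
  apply: cvgB; first exact: cvg_cst.
  by apply: dot_cvg => //; exact: cvg_cst.
have A_ge i : dot (a i) q <= A i.
  rewrite leNgt; apply/negP => h.
  pose D := (dot (a i) q - A i) / 2.
  have D0 : 0 < D by rewrite divr_gt0// subr_gt0.
  have h1 : \forall t \near F, l i t < - D.
    by apply: (cvgr_lt _ (lq i)); rewrite /D; lra.
  suff : \forall t \near F, False by move/filter_ex => [].
  near=> t.
  have g1 : l i t < - D by near: t.
  have g2 : D^-1 < height (z t) by near: t; exact: hH.
  have g3 : forall i, -1 <= lin (a i) (A i) (z t) by near: t.
  have := g3 i; rewrite LE leNgt => /negP; apply.
  have h0 := height_gt0 (z t).
  apply: lt_trans (_ : height (z t) * - D < _); first by rewrite ltr_pM2l.
  rewrite mulrN ltrN2; rewrite -[D^-1]mul1r ltr_pdivrMr// in g2.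
have [|i|c c0 hc] := @fin_radius R n (fun i c => A i != dot (a i) q -> c < A i - dot (a i) q).
- by move=> i r r' _ rr h /h; exact: le_lt_trans.
- have [e|ne] := eqVneq (A i) (dot (a i) q); first by exists 1.
  have p : 0 < A i - dot (a i) q by rewrite subr_gt0 lt_neqAle eq_sym ne A_ge.
  by exists ((A i - dot (a i) q) / 2) => [|_]; lra.
exists q, c; split => //.
apply: filter_forall => i.
have [e|ne] := eqVneq (A i) (dot (a i) q); first exact: filterE.
have h1 : \forall t \near F, c < l i t by apply: (cvgr_gt _ (lq i)); exact: hc.
apply: filterS h1 => t h _; rewrite LE mulrC ler_pM2l ?height_gt0//; exact: ltW.
Unshelve. all: by end_near. Qed.

Lemma deep_point (R : realType) (d : nat) (a : 'rV[R]_d.+1) (A : R) : 0 < A ->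
  dot a a = 1 + A ^+ 2 -> exists z, lin a A z <= -2.
Proof.
move=> A0 aa; pose B := Num.sqrt (1 + A ^+ 2).
have B2 : B ^+ 2 = 1 + A ^+ 2 by rewrite sqr_sqrtr// addr_ge0// sqr_ge0.
have B0 : 0 < B by rewrite sqrtr_gt0 ltr_pwDl// sqr_ge0.
have BA : 0 < B - A.
  by rewrite subr_gt0 -(@ltr_pXn2r _ 2)// ?nnegrE ?ltW// B2 ltrDr.
(* On the ray through [a] the height is at most [1 + t * B], so [lin] is at most
   [A - t * B * (B - A)], which is [-2] here. *)
pose t := (A + 2) / (B * (B - A)).
have t0 : 0 < t by rewrite divr_gt0 ?mulr_gt0// addr_gt0.
exists (t *: a); rewrite /lin dotZr aa -B2.
have hh : height (t *: a) <= 1 + t * B.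
  rewrite /height dotZl dotZr aa -B2 -(@ler_pXn2r _ 2)// ?nnegrE ?sqrtr_ge0//; last first.
    by rewrite addr_ge0// mulr_ge0// ltW.
  have p : 0 < t * B by rewrite mulr_gt0.
  have p2 : t * (t * B ^+ 2) = (t * B) ^+ 2 by ring.
  by rewrite p2 sqr_sqrtr ?addr_ge0 ?sqr_ge0//; nra.
have e : t * B * (B - A) = A + 2 by rewrite /t; field; rewrite !gt_eqF.
have : A * height (t *: a) <= A * (1 + t * B) by rewrite ler_pM2l.
nra.
Qed.

(** * The centering theorem *)

Section Centering.
Variables (R : realType) (d n : nat).
Variables (a : 'I_n -> 'rV[R]_d.+1) (A : 'I_n -> R).
Hypothesis A_gt0 : forall i, 0 < A i.
Hypothesis aa : forall i, dot (a i) (a i) = 1 + A i ^+ 2.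
Variables (phi h : 'I_n -> R -> R) (K : R).
Hypothesis phi_cont : forall i t, 0 < t -> {for t, continuous (phi i)}.
Hypothesis phi_gt0 : forall i t, 0 < t -> 0 < phi i t.
Hypothesis phi_pinfty : forall i M, exists2 e, 0 < e &
  forall t, 0 < t -> t < e -> M < phi i t.
Hypothesis phi_le : forall i t, 0 < t -> t <= 1 -> t * phi i t <= K.
Hypothesis h1 : forall i, h i 1 = 0.
Hypothesis dh : forall i (t : R), 0 < t -> is_derive t 1 (h i) (phi i t).
Hypothesis balance : forall q, @sphere R d q -> exists al be, [/\ al < be,
  exists2 e, 0 < e & forall t, 0 < t -> t < e ->
    \sum_(i < n | A i == dot (a i) q) t * phi i t <= al
& exists2 M, 0 < M & forall t, M <= t ->
    be <= \sum_(i < n | A i != dot (a i) q) t * phi i t].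
Let L i z := lin (a i) (A i) z.

Section Level.
Variables (k : R) (psi e : 'I_n -> R -> R) (s : 'I_n -> R).
Hypothesis tr : forall i, truncated (phi i) K (h i) k (psi i) (e i) (s i).

Lemma truncated_mono i x y : x <= y -> e i x <= e i y.
Proof.
move=> xy; have := @incr_le _ (cst 0) (e i) (cst 0) (psi i) x y xy.
have de := tr_derive (tr i).
rewrite subrr subr_ge0; apply => u _; exact: ltW (tr_gt0 (tr i) u).
Qed.

Lemma pot_lower q z D X : 0 <= D ->
  (forall i, A i = dot (a i) q -> - D <= k ^+ 2 * L i z) ->
  (forall i, A i != dot (a i) q -> X <= L i z) -> 0 <= 1 + K + D ->
  \sum_(i < n | A i == dot (a i) q) h i (k ^+ 2)^-1 - n%:R * (1 + K + D) +
    \sum_(i < n | A i != dot (a i) q) e i X <= pot a A e z.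
Proof.
move=> D0 hI hJ KD; rewrite /pot [leRHS](bigID (fun i => A i == dot (a i) q))/= lerD//; last first.
  by apply: ler_sum => i /hJ; exact: truncated_mono.
apply: le_trans (_ : \sum_(i < n | A i == dot (a i) q) (h i (k ^+ 2)^-1 - (1 + K + D)) <= _).
  rewrite sumrB lerD2l lerN2 mulr_natl -[X in _ *+ X](card_ord n) -sumr_const [leLHS]big_mkcond /=.
  by apply: ler_sum => i _; case: ifP.
apply: ler_sum => i /eqP /hI iD.
by have := tr_lower (tr i) D0 iD; lra.
Qed.

End Level.

Lemma truncated_high N : exists2 K', K <= K' & forall k psi e s,
  (forall i, truncated (phi i) K (h i) k (psi i) (e i) (s i)) ->
  forall i t, t <= N -> t * psi i t <= K'.
Proof.
pose N1 := Num.max N 1.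
have N11 : 1 <= N1 by rewrite le_max lexx orbT.
have /choice[P hP] : forall i, exists P, forall t, 1 <= t -> t <= N1 -> t * phi i t <= P.
  move=> i; have cw : {within `[1, N1], continuous (fun t => t * phi i t)}.
    apply: continuous_in_subspaceT => t /set_mem; rewrite /= in_itv/= => /andP[t1 _].
    apply: cvgM; first exact: cvg_id.
    by apply: phi_cont; exact: lt_le_trans t1.
  have [c _ hc] := EVT_max N11 cw; exists (c * phi i c) => t t1 t2.
  by apply: hc; rewrite in_itv/= t1.
exists (`|K| + \sum_(i < n) `|P i|).
  by apply: le_trans (ler_norm K) _; rewrite lerDl sumr_ge0.
move=> k psi e s tr i t tN.
have Pi : P i <= \sum_(i < n) `|P i|.
  by apply: le_trans (ler_norm _) _; rewrite (bigD1 i)//= lerDl sumr_ge0.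
have := ler_norm K; have := normr_ge0 K.
have S0 : 0 <= \sum_(i < n) `|P i| by apply: sumr_ge0.
have [t1|/ltW t1] := leP t 1; first by have := tr_leK (tr i) t1; lra.
have : t * psi i t <= t * phi i t.
  rewrite ler_pM2l; last exact: lt_le_trans t1.
  by rewrite (tr_min (tr i) t1) ge_min lexx.
have := hP i t t1; rewrite le_max tN => /(_ isT); lra.
Qed.

(** For fixed [k], along points escaping to [q] the caps through [q] contribute at least a constant,
    and the others grow at least like a positive multiple of the logarithm of the height. *)
Lemma proper_pot k psi e s c : 0 < k -> n%:R <= k ->
  (forall i, truncated (phi i) K (h i) k (psi i) (e i) (s i)) ->
  exists M, forall z, pot a A e z <= c -> (forall i, - (n%:R / k) <= L i z) ->
    height z <= M.
Proof.
move=> k0 nk tr; apply: contrapT => nM.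
have /choice[z hz] : forall m : nat, exists z, [/\ pot a A e z <= c,
    forall i, - (n%:R / k) <= L i z & m%:R < height z].
  move=> m; apply: contrapT => nz; apply: nM; exists m%:R => z zc zL.
  by rewrite leNgt; apply/negP => mz; apply: nz; exists z.
have [G [GU Gsub]] := @ultraFilterLemma _ (@eventually) _.
have hH M : \forall t \near G, M < height (z t).
  have : \forall m \near \oo, M < m%:R by apply: nbhs_infty_gtr.
  move/Gsub; apply: filterS => m Mm; have [_ _] := hz m; exact: lt_trans.
have nk1 : n%:R / k <= 1 by rewrite ler_pdivrMr// mul1r.
have [|q [cc [qs _ A_ge cc0 hJ]]] := @far_caps R d n a A _ G GU z hH.
  by apply: filterE => t i; have [_ /(_ i) + _] := hz t; rewrite /L; lra.
have [al [be [albe [e0 e00 he] [M M0 hM]]]] := balance qs.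
have al0 : 0 <= al.
  have e2 : e0 / 2 < e0 by lra.
  have e20 : 0 < e0 / 2 by lra.
  apply: le_trans (he _ e20 e2); apply: sumr_ge0 => i _.
  by rewrite mulr_ge0 ?ltW// phi_gt0.
(* [high_growth] needs a rate of at most [k], which is fixed here and may be smaller than [be]. *)
pose be' := Num.min be k.
have be'0 : 0 < be' by rewrite lt_min k0 (le_lt_trans al0).
have [t Mt|C hC] := @high_growth R n phi h K (fun i => A i != dot (a i) q) be' M be'0 M0.
  by apply: le_trans (hM t Mt); rewrite ge_min lexx.
have bek : be' <= k by rewrite ge_min lexx orbT.
have {}hC := hC k psi e s bek tr.
pose D := `|K| + n%:R * k.
have D0 : 0 <= D by rewrite addr_ge0// mulr_ge0// ltW.
have KD : 0 <= 1 + K + D.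
  have := ler_norm (- K); rewrite normrN /D => hK.
  by have : 0 <= n%:R * k by [rewrite mulr_ge0// ltW]; lra.
pose C1 := \sum_(i < n | A i == dot (a i) q) h i (k ^+ 2)^-1 - n%:R * (1 + K + D).
suff : \forall t \near G, False by move/filter_ex => [].
near=> t.
have g1 : forall i, A i != dot (a i) q -> cc * height (z t) <= L i (z t) by near: t.
have g2 : Num.max 1 (expR ((c + C - C1 + 1) / be')) / cc < height (z t) by near: t; exact: hH.
move: g2; rewrite ltr_pdivrMr// gt_max mulrC => /andP[g2 g3].
have [zc zL _] := hz t.
have g4 := hC _ (ltW g2).
have cH0 := lt_trans ltr01 g2.
have g5 : (c + C - C1 + 1) / be' < ln (cc * height (z t)).
  by rewrite -ltr_expR lnK ?posrE.
rewrite ltr_pdivrMr// mulrC in g5.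
have g6 i : A i = dot (a i) q -> - D <= k ^+ 2 * L i (z t).
  move=> _; apply: le_trans (_ : k ^+ 2 * - (n%:R / k) <= _); last first.
    by rewrite ler_wpM2l ?sqr_ge0.
  have -> : k ^+ 2 * - (n%:R / k) = - (n%:R * k) by field; rewrite gt_eqF.
  by rewrite lerN2 lerDr.
have := pot_lower tr D0 g6 g1 KD; rewrite -/C1; lra.
Unshelve. all: by end_near. Qed.

Variable P : pred 'I_n.
Hypothesis split : forall i j z, P i -> ~~ P j -> 0 <= L i z \/ 0 <= L j z.
Hypothesis P_ex : exists i, P i.
Hypothesis nP_ex : exists i, ~~ P i.

Let seg_bound y : exists N, forall i z, seg 0 y 1 z -> L i z <= N.
Proof.
exists (\sum_(i < n) (A i * height y + `|dot (a i) y|)) => i z [t /= + <-].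
rewrite in_itv/= add0r => /andP[t0 t1].
rewrite (bigD1 i)//=; apply: le_trans (_ : A i * height y + `|dot (a i) y| <= _); last first.
  rewrite lerDl; apply: sumr_ge0 => j _; rewrite addr_ge0// mulr_ge0 ?ltW//; exact: height_gt0.
rewrite /L /lin lerD//.
  rewrite ler_pM2l// ler_sqrt ?addr_ge0 ?dot_ge0//.
  rewrite lerD2l dotZl dotZr mulrA -[leRHS]mul1r ler_wpM2r ?dot_ge0//.
  by rewrite -expr2 expr_le1.
rewrite dotZr; apply: le_trans (ler_norm _) _; rewrite normrN normrM (ger0_norm t0).
by rewrite ler_piMl.
Qed.

Lemma truncated_critical : exists c0, forall k psi e s, 0 < k -> n%:R <= k ->
  (forall i, truncated (phi i) K (h i) k (psi i) (e i) (s i)) ->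
  exists2 z, pot a A e z <= c0 & forall v, dpot a A psi v z = 0.
Proof.
have [i Pi] := P_ex; have [j Pj] := nP_ex.
have [x Lx] := deep_point (A_gt0 i) (aa i).
have [y Ly] := deep_point (A_gt0 j) (aa j).
have [Nx hx] := seg_bound x; have [Ny hy] := seg_bound y.
pose N := Num.max 1 (Num.max Nx Ny).
have N1 : 1 <= N by rewrite le_max lexx.
(* The path from [x] through the origin to [y] is chosen before [k]. On it every [L i] is at most
   [N], and [tr_upper] replaces the truncated antiderivatives at [N >= 1] by the original ones. *)
exists (\sum_(i < n) h i N) => k psi e s k0 nk tr.
have nk1 : n%:R / k <= 1 by rewrite ler_pdivrMr// mul1r.
apply: (@critical_point R d n a A A_gt0 psi e _ _ _ k s k0 _ _ _ P _ (seg 0 x 1 `|` seg 0 y 1)).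
- by move=> l; exact: tr_cont (tr l).
- by move=> l; exact: tr_gt0 (tr l).
- by move=> l; exact: tr_derive (tr l).
- by move=> l; exact: tr_s0 (tr l).
- by move=> l; exact: tr_le (tr l).
- by move=> l; exact: tr_low (tr l).
- exact: split.
- by move=> c; exact: proper_pot tr.
- apply: connectedU; [|exact: seg_connected|exact: seg_connected].
  exists 0; split; exists 0; rewrite ?scale0r ?addr0//= in_itv/= lexx ler01//.
- move=> z hz; apply: ler_sum => l _; apply: le_trans (tr_upper (tr l) N1).
  apply: (truncated_mono tr); rewrite !le_max; by case: hz => [/hx|/hy] ->; rewrite ?orbT.
- exists x, i; split => //; last by rewrite -/(L i x); rewrite /L; lra.
  by left; exists 1; rewrite ?scale1r ?add0r//= in_itv/= lexx ler01.
- exists y, j; split => //; last by rewrite -/(L j y); rewrite /L; lra.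
  by right; exists 1; rewrite ?scale1r ?add0r//= in_itv/= lexx ler01.
Qed.

(** A frozen force [k ^+ 2] would make the left side of [critical_height] at least [k ^+ 2 * A i],
    while bounded heights bound the right side uniformly in [k]. *)
Lemma bounded_genuine M : exists k1, forall k psi e s z, k1 <= k -> 0 < k ->
  (forall i, truncated (phi i) K (h i) k (psi i) (e i) (s i)) ->
  (forall v, dpot a A psi v z = 0) -> height z <= M ->
  forall i, s i <= L i z /\ L i z * psi i (L i z) < k.
Proof.
pose B := \sum_(i < n) (A i * M + Num.sqrt (1 + A i ^+ 2) * M).
have LB i z : height z <= M -> L i z <= B.
  move=> zM; have M0 : 0 <= M := le_trans (ltW (height_gt0 z)) zM.
  rewrite /B (bigD1 i)//= -[leLHS]addr0 lerD//; last first.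
    by apply: sumr_ge0 => j _; rewrite addr_ge0// mulr_ge0 ?sqrtr_ge0// ltW.
  rewrite /L /lin lerD//; first by rewrite ler_pM2l.
  rewrite -dotNr; apply: le_trans (dot_le_norm _ _) _.
  rewrite dotNl dotNr opprK aa ler_wpM2l ?sqrtr_ge0//; apply: le_trans zM.
  by rewrite /height ler_sqrt ?lerDr// addr_ge0// dot_ge0.
have [K' KK' hK'] := truncated_high B.
have [|i|r r0 hr] := @fin_radius R n (fun i r => r <= A i).
- by move=> i r r' _; exact: le_trans.
- by exists (A i).
exists (Num.max (`|K'| + 1) (n%:R * `|K'| * `|M| / r + 1)) => k psi e s z.
rewrite ge_max => /andP[k1 k2] k0 tr crit zM i.
have K'k := ler_norm K'.
have high j : L j z * psi j (L j z) <= K' by apply: (hK' _ _ _ _ tr); exact: LB.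
split; last by apply: le_lt_trans (high i) _; lra.
rewrite leNgt; apply/negP => Ls.
have := critical_height crit.
rewrite (bigD1 i)//= (tr_low (tr i) (ltW Ls)) => e1.
have H0 := height_gt0 z.
have e2 : k ^+ 2 * r <= n%:R * `|K'| * `|M|.
  apply: le_trans (_ : mult a A psi z * height z <= _).
    rewrite -e1 -[leLHS]addr0 lerD//; first by rewrite ler_wpM2l ?sqr_ge0.
    by apply: sumr_ge0 => j _; rewrite mulr_ge0 ?ltW//; exact: tr_gt0 (tr j) _.
  apply: le_trans (_ : n%:R * `|K'| * height z <= _); last first.
    rewrite ler_wpM2l ?mulr_ge0//; exact: le_trans (ler_norm M).
  rewrite ler_pM2r// /mult mulr_natl -[X in _ *+ X](card_ord n) -sumr_const.
  by apply: ler_sum => j _; rewrite mulrC; apply: le_trans (high j) K'k.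
rewrite -ler_pdivlMr// in e2.
have := normr_ge0 K'; nra.
Qed.

Lemma centering : exists z, (forall i, 0 < L i z) /\
  forall v, \sum_(i < n) phi i (L i z) * dlin (a i) (A i) v z = 0.
Proof.
apply: contrapT => nz.
have [i0 _] := P_ex.
have n0 : (0 < n)%N by case: n i0 => [[]|].
have /choice[k0 hk0] : forall i, exists k0, forall k, k0 <= k ->
    exists psi e s, truncated (phi i) K (h i) k psi e s.
  move=> i; exact: (@truncation R (phi i) K (@phi_cont i) (@phi_gt0 i) (@phi_pinfty i) (@phi_le i) (h i) (h1 i) (@dh i)).
pose k m : R := 1 + n%:R + \sum_(i < n) `|k0 i| + m%:R.
have S0 : 0 <= \sum_(i < n) `|k0 i| by apply: sumr_ge0.
have nR : 0 <= n%:R :> R by [].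
have k_ge1 m : 1 <= k m by rewrite /k; have : 0 <= m%:R :> R by []; lra.
have k_gt0 m : 0 < k m by exact: lt_le_trans (k_ge1 m).
have k_n m : n%:R <= k m by rewrite /k; have : 0 <= m%:R :> R by []; lra.
have k_k0 m i : k0 i <= k m.
  apply: le_trans (ler_norm _) _.
  have : `|k0 i| <= \sum_(i < n) `|k0 i| by rewrite (bigD1 i)//= lerDl sumr_ge0.
  by rewrite /k; have : 0 <= m%:R :> R by []; lra.
have [c0 hc0] := truncated_critical.
have /choice[X hX] : forall m, exists X : ('I_n -> R -> R) * ('I_n -> R) * 'rV[R]_d.+1,
    exists e, [/\ forall i, truncated (phi i) K (h i) (k m) (X.1.1 i) (e i) (X.1.2 i),
    pot a A e X.2 <= c0 & forall v, dpot a A X.1.1 v X.2 = 0].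
  move=> m; have /choice[f hf] : forall i, exists f : (R -> R) * (R -> R) * R,
      truncated (phi i) K (h i) (k m) f.1.1 f.1.2 f.2.
    by move=> i; have [psi [e [s tr]]] := hk0 i (k m) (k_k0 m i); exists (psi, e, s).
  have [z zc0 crit] := hc0 (k m) (fun i => (f i).1.1) (fun i => (f i).1.2) (fun i => (f i).2)
    (k_gt0 m) (k_n m) hf.
  by exists (fun i => (f i).1.1, fun i => (f i).2, z); exists (fun i => (f i).1.2).
have {hX} /choice[e hX] := hX.
pose psi m := (X m).1.1; pose s m := (X m).1.2; pose z m := (X m).2.
have tr m : forall i, truncated (phi i) K (h i) (k m) (psi m i) (e m i) (s m i).
  by have [] := hX m.
have zc0 m : pot a A (e m) (z m) <= c0 by have [] := hX m.
have crit m : forall v, dpot a A (psi m) v (z m) = 0 by have [] := hX m.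
have ng m : exists i, ~ (s m i <= L i (z m) /\ L i (z m) * psi m i (L i (z m)) < k m).
  apply: contrapT => /forallNP hm; apply: nz; exists (z m).
  have {}hm i : s m i <= L i (z m) /\ L i (z m) * psi m i (L i (z m)) < k m.
    exact: contrapT (hm i).
  split=> [i|v]; first by have [h' _] := hm i; apply: lt_le_trans h'; exact: tr_s0 (tr m i).
  apply: etrans (crit m v); apply: eq_bigr => i _; have [u1 u2] := hm i.
  by rewrite (tr_eq (tr m i) u1 u2).
have [G [GU Gsub]] := @ultraFilterLemma _ (@eventually) _.
have k_large Y : \forall m \near G, Y < k m.
  have : \forall m \near \oo, Y < m%:R by apply: nbhs_infty_gtr.
  move/Gsub; apply: filterS => m /lt_le_trans; apply.
  by rewrite /k lerDr !addr_ge0.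
have height_large M : \forall m \near G, M < height (z m).
  have [//|GM] := in_ultra_setVsetC [set m | M < height (z m)] GU.
  have [k1 hk1] := bounded_genuine M.
  have [m [km zM]] : exists m, k1 < k m /\ ~ (M < height (z m)).
    by have [m hm] := filter_ex (filterI (k_large k1) GM); exists m.
  have [i []] := ng m; move: zM => /negP; rewrite -leNgt => zM.
  exact: hk1 (ltW km) (k_gt0 m) (tr m) (crit m) zM i.
pose eps m := n%:R / k m.
have L_ge m i : - eps m <= L i (z m).
  rewrite leNgt; apply/negP => /ltW hL.
  have := mult_gt0 A_gt0 (fun i => tr_gt0 (tr m i)) n0 (crit m).
  have := mult_lt0 (k_gt0 m) (fun i => tr_s0 (tr m i)) (fun i => tr_le (tr m i)) (fun i => tr_low (tr m i)) hL.
  by move=> /lt_trans hh /hh; rewrite ltxx.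
have eps_small y : 0 < y -> \forall m \near G, eps m < y.
  move=> y0; have := k_large (n%:R / y); apply: filterS => m.
  by rewrite /eps ltr_pdivrMr// ltr_pdivrMr// mulrC.
have [|q [c [qs xq A_ge c_gt0 L_large]]] := @far_caps R d n a A _ G GU z height_large.
  near=> m => i; have : eps m < 1 by near: m; exact: eps_small.
  by have := L_ge m i; rewrite /L; lra.
have [al [be [albe [e0 e00 he] [M M0 hM]]]] := balance qs.
have al0 : 0 <= al.
  have e2 : e0 / 2 < e0 by lra.
  have e20 : 0 < e0 / 2 by lra.
  apply: le_trans (he _ e20 e2); apply: sumr_ge0 => i _.
  by rewrite mulr_ge0 ?ltW// phi_gt0.
have be0 : 0 < be := le_lt_trans al0 albe.
have J_neq0 : exists i, A i != dot (a i) q.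
  apply: contrapT => /forallNP nJ; have := hM M (lexx M).
  by rewrite big1 ?leNgt ?be0// => i /nJ.
have K0 : 0 < K.
  have := phi_le i0 ltr01 (lexx 1); rewrite mul1r; apply: lt_le_trans; exact: phi_gt0.
have est := @far_estimate R d n a A A_gt0 aa _ G GU z psi eps K
  (fun m i => tr_gt0 (tr m i)) crit (fun m i => tr_leK (tr m i)) L_ge eps_small
  q qs xq J_neq0 A_ge c c_gt0 L_large.
have [C1 hC1] := @low_growth R n phi h phi_gt0 dh (fun i => A i == dot (a i) q) al e0 e00 he.
have [C2 hC2] := @high_growth R n phi h K (fun i => A i != dot (a i) q) be M be0 M0 hM.
have [|i|r r0 hr] := @fin_radius R n (fun i r => r <= A i).
- by move=> i y y' _; exact: le_trans.
- by exists (A i).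
pose nK := n%:R * K.
have n0R : 0 < n%:R :> R by rewrite ltr0n.
have nK0 : 0 < nK by rewrite mulr_gt0.
(* From [k ^+ 2 * r <= mult * height <= 5 * nK * height], where [r] is a lower bound for all
   [A i]. *)
pose c2 := r / (5 * nK).
have c20 : 0 < c2 by rewrite divr_gt0// mulr_gt0.
(* Once [ln (k ^+ 2) > Y], the lower bound [(be - al) * ln (k ^+ 2) + be * ln (c * c2) - C1 - C2 - n
   * (1 + K + nK)] of the level exceeds [c0]. *)
pose Y := (c0 + C1 + C2 + n%:R * (1 + K + nK) - be * ln (c * c2)) / (be - al).
suff : \forall m \near G, False by move/filter_ex => [].
near=> m.
have [g1 g2 g3] : [/\ mult a A (psi m) (z m) <= 5 * n%:R * K,
      forall i, A i != dot (a i) q -> 0 < L i (z m) /\ psi m i (L i (z m)) * L i (z m) <= 2 * n%:R * K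
    & forall i, A i = dot (a i) q -> L i (z m) <= 1 /\ - nK <= psi m i (L i (z m)) * L i (z m)].
  by near: m; exact: est.
have g4 : 1 / c < height (z m) by near: m; exact: height_large.
have g5 : 2 * nK < k m by near: m; exact: k_large.
have g6 : K < k m by near: m; exact: k_large.
have g7 : expR Y < k m by near: m; exact: k_large.
have g8 : be < k m by near: m; exact: k_large.
have g9 : 1 / (c * c2) < k m by near: m; exact: k_large.
have g10 : forall i, A i != dot (a i) q -> c * height (z m) <= L i (z m) by near: m.
have k1 := k_ge1 m; have kp := k_gt0 m; have H0 := height_gt0 (z m).
have kk : k m <= k m ^+ 2 by rewrite expr2 ler_peMr// ltW.
rewrite -mulrA -/nK in g1.
(* A cap that is not in the untruncated range passes through [q] and lies
   below its truncation level, which forces the height to be of order [k ^ 2]. *)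
have [i [Ai Ls]] : exists i, A i = dot (a i) q /\ L i (z m) < s m i.
  have [i hi] := ng m; exists i.
  have [Ai|Ji] := eqVneq (A i) (dot (a i) q); last first.
    exfalso; apply: hi; have [u1 u2] := g2 i Ji.
    split; last by rewrite mulrC; apply: le_lt_trans u2 _; rewrite -mulrA.
    rewrite leNgt; apply/negP => Ls.
    move: u2; rewrite (tr_low (tr m i) (ltW Ls)) -mulrA -/nK => u2.
    have L1 : 1 <= L i (z m).
      by apply: le_trans (g10 i Ji); rewrite mulrC -ler_pdivrMr// ltW.
    have : k m ^+ 2 * 1 <= k m ^+ 2 * L i (z m) by rewrite ler_wpM2l// sqr_ge0.
    lra.
  split=> //; rewrite ltNge; apply/negP => sL; apply: hi; split=> //.
  by apply: le_lt_trans g6; apply: tr_leK (tr m i) _ _; have [] := g3 i Ai.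
have Hk : c2 * k m ^+ 2 <= height (z m).
  have := critical_height (crit m).
  rewrite (bigD1 i)//= (tr_low (tr m i) (ltW Ls)) => e1.
  have e2 : k m ^+ 2 * r <= 5 * nK * height (z m).
    apply: le_trans (_ : mult a A (psi m) (z m) * height (z m) <= _); last by rewrite ler_pM2r.
    rewrite -e1 -[leLHS]addr0 lerD//; first by rewrite ler_wpM2l ?sqr_ge0.
    by apply: sumr_ge0 => j _; rewrite mulr_ge0 ?ltW//; exact: tr_gt0 (tr m j) _.
  rewrite /c2 mulrAC ler_pdivrMr ?mulr_gt0// mulrC; lra.
(* At a negative [L j] the force is exactly [k ^+ 2], so the bound on the product is the one
   required. *)
have D1 j : A j = dot (a j) q -> - nK <= k m ^+ 2 * L j (z m).
  move=> /g3 [_ u]; have [L0|L0] := leP 0 (L j (z m)).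
    by apply: le_trans (_ : 0 <= _); [rewrite oppr_le0 ltW|rewrite mulr_ge0 ?sqr_ge0].
  rewrite -(tr_low (tr m j) (_ : L j (z m) <= s m j))//.
  by apply: ltW; apply: lt_trans L0 _; exact: tr_s0 (tr m j).
have D2 j : A j != dot (a j) q -> c * (c2 * k m ^+ 2) <= L j (z m).
  by move=> /g10; apply: le_trans; rewrite ler_pM2l.
have D3 : 0 <= 1 + K + nK by lra.
have pl := pot_lower (tr m) (ltW nK0) D1 D2 D3.
have k20 : 0 < k m ^+ 2 by rewrite exprn_gt0.
have i1 : 0 < (k m ^+ 2)^-1 by rewrite invr_gt0.
have i2 : (k m ^+ 2)^-1 <= 1 by rewrite invf_le1// (le_trans k1).
have l1 := hC1 _ i1 i2.
have cc : 0 < c * c2 by rewrite mulr_gt0.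
have t1 : 1 <= c * (c2 * k m ^+ 2).
  rewrite mulrA mulrC -ler_pdivrMr//; apply: le_trans (ltW g9) kk.
have l2 := hC2 (k m) (psi m) (e m) (s m) (ltW g8) (tr m) _ t1.
rewrite lnV ?posrE// in l1.
rewrite mulrA lnM ?posrE// in l2.
have l3 : Y < ln (k m ^+ 2).
  by rewrite -ltr_expR lnK ?posrE//; exact: lt_le_trans kk.
rewrite /Y ltr_pdivrMr ?subr_gt0// in l3.
have := zc0 m; move: pl l1 l2 l3; rewrite mulrA; lra.
Unshelve. all: by end_near. Qed.

End Centering.

(** The weighted normals [(a i, A i)] sum up to a multiple of the hyperboloid point over [z]. The
    reflection sends it to a multiple of the apex, whose space part is zero. *)
Lemma boost_normal_balance (R : realType) (d n : nat) (a : 'I_n -> 'rV[R]_d.+1)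
    (A : 'I_n -> R) (phi : 'I_n -> R -> R) z :
  (forall v, dpot a A phi v z = 0) ->
  \sum_(i < n) phi i (lin (a i) (A i) z) *: boost_normal (a i) (A i) z = 0.
Proof.
move=> crit; set V := \sum_(i < n) _.
suff h v : dot V v = 0 by apply/eqP; rewrite -dot_eq0 h.
rewrite /V dot_suml.
have e1 := critical_height crit; have e2 := critical_dot crit v; have e3 := critical_dot crit z.
have -> : \sum_(i < n) dot (phi i (lin (a i) (A i) z) *: boost_normal (a i) (A i) z) v =
  \sum_(i < n) phi i (lin (a i) (A i) z) * dot (a i) v
  - (\sum_(i < n) phi i (lin (a i) (A i) z) * dot (a i) z) / (height z - 1) * dot z v
  + (\sum_(i < n) phi i (lin (a i) (A i) z) * A i) * dot z v.
  rewrite !mulr_suml -sumrB -big_split; apply: eq_bigr => i _ /=.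
  by rewrite /boost_normal !dotE; ring.
rewrite e1 e2 e3; have [->|/height_gt1 h1] := eqVneq z 0; first by rewrite dot0l; ring.
by rewrite dotzz; field; rewrite gt_eqF// subr_gt0.
Qed.

Lemma sin_acot (R : realType) (t : R) : sin (acot t) = (Num.sqrt (1 + t ^+ 2))^-1.
Proof. by rewrite /acot sinB cos_pihalf sin_pihalf mul0r subr0 mul1r cos_atan. Qed.

Lemma ereal_between2 (R : realType) (x y : \bar R) : (x < y)%E ->
  exists al be : R, [/\ (x < al%:E)%E, al < be & (be%:E < y)%E].
Proof.
case: x => [r||]; case: y => [r'||] //.
- rewrite lte_fin => rr; exists (r + (r' - r) / 3), (r + 2 * (r' - r) / 3).
  by rewrite !lte_fin; split; lra.
- by move=> _; exists (r + 1), (r + 2); rewrite lte_fin ltry; split=> //; lra.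
- by move=> _; exists (r' - 2), (r' - 1); rewrite lte_fin ltNyr; split=> //; lra.
- by move=> _; exists 0, 1; rewrite ltry ltNyr; split.
Qed.

Unset Implicit Arguments.
Set Strict Implicit.

Theorem theorem4 (R : realType) (d n : nat) (hd : (2 <= d)%N)
    (C : 'I_n -> set 'rV[R]_d.+1)
    (hC : forall i : 'I_n, exists c rho, is_cap (C i) c rho)
    (hdisc : ~ connected (\bigcup_(i in [set: 'I_n]) sinterior (C i)))
    (w : 'I_n -> R -> R)
    (wpos : forall (i : 'I_n) (t : R), 0 < t -> t < pi / 2 -> 0 < w i t)
    (wsmooth : forall i : 'I_n, smooth_on_itv 0 (pi / 2) (w i))
    (wlim : forall i : 'I_n, w i t @[t --> (pi / 2 : R)^'-] --> +oo)
    (hq : forall q : 'rV[R]_d.+1, sphere q ->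
      exists a b : \bar R,
        [/\ (\sum_(i < n | q \in sboundary (C i)) w i t * cos t)%:E
              @[t --> (pi / 2 : R)^'-] --> a,
            (\sum_(i < n | q \notin sboundary (C i)) w i t)%:E
              @[t --> (0 : R)^'+] --> b
          & (a < b)%E]) :
  exists (T : 'rV[R]_d.+1 -> 'rV[R]_d.+1)
         (cT : 'I_n -> 'rV[R]_d.+1) (rhoT : 'I_n -> R),
    [/\ moebius T,
        forall i : 'I_n, is_cap (T @` C i) (cT i) (rhoT i)
      & \sum_(i < n) w i (rhoT i) *: cT i = 0].
Proof.
have /choice[c /choice[rho cap]] := hC.
have [P [P_ex nP_ex split]] := caps_split cap hdisc.
pose a i := slope (c i) (rho i); pose A i := slope0 (rho i).
have A_gt0 i : 0 < A i by have [_ r0 r1 _] := cap i; exact: slope0_gt0.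
have aa i : dot (a i) (a i) = 1 + A i ^+ 2 by have [cs r0 r1 _] := cap i; exact: slope_sq.
have bdE q i : @sphere R d q -> (q \in sboundary (C i)) = (A i == dot (a i) q).
  move=> qs; have [cs r0 r1 _] := cap i; have s0 := sin_rho_gt0 r0 r1.
  have -> : (A i == dot (a i) q) = (dot (c i) q == cos (rho i)).
    rewrite /A /a /slope /slope0 dotZl mulrC eq_sym.
    by apply/eqP/eqP => [/mulfI|->//]; apply; rewrite invr_neq0// gt_eqF.
  rewrite (cap_sboundary (cap i)); apply/idP/eqP; first by move/set_mem => [].
  by move=> e; apply/mem_set.
have balance0 q : @sphere R d q -> exists al be, [/\ al < be,
    exists2 e, 0 < e & forall t, 0 < t -> t < e ->
      \sum_(i < n | A i == dot (a i) q) t * force w i t <= al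
  & exists2 M, 0 < M & forall t, M <= t ->
      be <= \sum_(i < n | A i != dot (a i) q) t * force w i t].
  move=> qs; have [x [y [hx hy xy]]] := hq q qs.
  have [al [be' [xal albe bey]]] := ereal_between2 xy.
  have [e e0 he] := force_near0 hx xal.
  have al0 : 0 <= al.
    have e2 : e / 2 < e by lra.
    have e20 : 0 < e / 2 by lra.
    apply: le_trans (he _ e20 e2); apply: sumr_ge0 => i _.
    by rewrite mulr_ge0 ?ltW// force_gt0.
  (* The midpoint stays above [al] and leaves the gap below [be'] that [force_near_pinfty]
     consumes. *)
  have be0 : 0 < (al + be') / 2 by lra.
  have bb : (al + be') / 2 < be' by lra.
  have [M M0 hM] := force_near_pinfty hy bey be0 bb.
  exists al, ((al + be') / 2); split; first lra.
    exists e => // t t0 te; apply: le_trans (he t t0 te).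
    by rewrite le_eqVlt; apply/orP; left; apply/eqP; apply: eq_bigl => i; rewrite bdE.
  exists M => // t Mt; apply: le_trans (hM t Mt) _.
  by rewrite le_eqVlt; apply/orP; left; apply/eqP; apply: eq_bigl => i; rewrite bdE.
have /choice[Ki hKi] : forall i, exists K, forall t, 0 < t -> t <= 1 -> t * force w i t <= K.
  move=> i; have [cs r0 r1 _] := cap i.
  have [|u us cu] := @exists_orthogonal R d (c i); first exact: leqW hd.
  (* A boundary point of the [i]-th cap: the sum bounded near [0] by the balance condition at [q]
     contains the [i]-th term, and all its terms are positive. *)
  pose q := cos (rho i) *: c i + sin (rho i) *: u.
  have qs : @sphere R d q.
    rewrite /sphere /= /q !dotE (dotC u) cu cs us.
    by rewrite -[RHS](cos2Dsin2 (rho i)); ring.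
  have [al [be [_ [e e0 he] _]]] := balance0 q qs.
  apply: (force_bound wpos wsmooth e0 _ he).
  by rewrite -bdE// (cap_sboundary (cap i)); apply/mem_set; split=> //; rewrite /q !dotE cu cs; ring.
pose K := \sum_(i < n) `|Ki i|.
have phi_le i t : 0 < t -> t <= 1 -> t * force w i t <= K.
  move=> t0 t1; apply: le_trans (hKi i t t0 t1) _; apply: le_trans (ler_norm _) _.
  by rewrite /K (bigD1 i)//= lerDl sumr_ge0.
have /choice[h hh] : forall i, exists h : R -> R, h 1 = 0 /\
    forall t : R, 0 < t -> is_derive t 1 h (force w i t).
  move=> i; have [|h h1 dh] := @positive_antiderivative R (force w i).
    by move=> t; exact: force_cont.
  by exists h.
have [z [Lz crit]] := @centering R d n a A A_gt0 aa (force w) h K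
  (fun i t => @force_cont R n w wsmooth i t) (fun i t => @force_gt0 R n w wpos i t)
  (fun i M => @force_pinfty R n w wlim i M)
  phi_le (fun i => (hh i).1) (fun i => (hh i).2) balance0 P split P_ex nP_ex.
exists (boost z), (fun i => sin (acot (lin (a i) (A i) z)) *: boost_normal (a i) (A i) z),
  (fun i => acot (lin (a i) (A i) z)); split.
- exact: moebius_boost.
- move=> i; have [cs r0 r1 ->] := cap i; exact: boost_cap cs r0 r1 (Lz i).
- rewrite -[RHS](boost_normal_balance crit); apply: eq_bigr => i _.
  by rewrite scalerA sin_acot.
Qed.
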